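(* Let $\mathcal{E}$ be a finite-dimensional Euclidean space, $\alpha\in(0,1)$, and let $T_1,\ldots,T_m:\mathcal{E}\to\mathcal{E}$ be $\alpha$-averaged operators such that $F:=\bigcap_{i=1}^m\mathrm{Fix}\,T_i$ is nonempty and $F\neq\mathcal{E}$. Let $\{x^k\}$ be generated by the quasi-cyclic algorithm $x^{k+1}=\sum_{i=1}^m w_i^kT_i(x^k)$, $k\in\mathbb{N}$, where $w_i^k\ge0$, $\sum_{i=1}^m w_i^k=1$, and $\nu:=\inf_{k\in\mathbb{N}}\min_{i\in I_+(k)}w_i^k>0$ with $I_+(k):=\{1\le i\le m\mid w_i^k>0\}$. Let $B$ be a bounded set containing $\{x^k\}$ and suppose that: (a) $T_1,\ldots,T_m$ are jointly Karamata regular (Karamata regular when $m=1$) over $B$ with regularity function $\psi_B$; (b) there exists an integer $s>0$ such that for each $k\in\mathbb{N}$, $I_+(k)\cup\cdots\cup I_+(k+s-1)=\{1,\ldots,m\}$. Fix any $\widehat a>\mathrm{dist}^2(x^0,F)$ and $\delta>0$ and define $$\widehat\phi(u):=\psi_B^2\Big(\sqrt{\tfrac{2\alpha(1+4\nu s)}{\nu(1-\alpha)}u}\Big),\qquad \phi:=\widehat\phi|_{(0,\widehat a]},\qquad \Phi_\phi(u):=\int_u^\delta\frac{1}{\phi^-(t)}\,dt,\quad u>0.$$ Let $\rho\in[0,1]$ denote the index of regular variation of $\psi_B|_{(0,a]}$ at $0$, and suppose that the convergence of $\{x^k\}$ is not finite. Then: (i) If $\rho=0$, then $\Phi_\phi\in\mathrm{RV}^0_{-\infty}$.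 In particular, $\Phi_\phi^{-1}\in\mathrm{RV}_0$ and for every $r>0$, $k^{-r}=o(\Phi_\phi^{-1}(k))$ as $k\to\infty$. (ii) If $\rho\in(0,1)$, then $\Phi_\phi\in\mathrm{RV}^0_{1-1/\rho}$. In particular, $\Phi_\phi^{-1}\in\mathrm{RV}_{\rho/(\rho-1)}$ and $\Phi_\phi^{-1}(k)=o(k^{-r})$ as $k\to\infty$ for every $0<r<-\rho/(\rho-1)$. (iii) Suppose that $\rho=1$ and $B$ is closed and connected. Then $\Phi_\phi\in\mathrm{RV}^0_0$. In particular, $\Phi_\phi^{-1}\in\mathrm{RV}_{-\infty}$ and for every $r>0$, $\Phi_\phi^{-1}(k)=o(k^{-r})$ as $k\to\infty$.
   Context: $\mathbb{N}$ includes $0$. $\mathrm{Fix}\,T=\{x\mid T(x)=x\}$. $T$ is $\alpha$-averaged if $T=(1-\alpha)I+\alpha R$ for some nonexpansive $R$. ''Finite convergence'' means that $\{x^k\}$ is eventually constant, equal to a point of $F$. Minus generalized inverse: for $f:(0,a]\to(0,\infty)$ with $\lim_{x\to0_+}f(x)=0$, $f^-(y):=\sup\{x\in(0,a]\mid f(x)<y\}$, $y>0$. $\Phi_\phi$ is continuous and decreasing on $(0,\infty)$ and $\Phi_\phi^{-1}$ is its usual inverse. Regular variation: a measurable $f:[a,\infty)\to(0,\infty)$ ($a>0$) is in $\mathrm{RV}_\rho$, $\rho\in\mathbb{R}$, if $\lim_{x\to\infty}f(\lambda x)/f(x)=\lambda^\rho$ for all $\lambda>0$; it is in $\mathrm{RV}_\infty$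 if this limit is $0$, $1$, $+\infty$ for $\lambda$ in $(0,1)$, $\{1\}$, $(1,\infty)$ respectively; $f\in\mathrm{RV}_{-\infty}$ if $1/f\in\mathrm{RV}_\infty$. A measurable $f:(0,a]\to(0,\infty)$ is in $\mathrm{RV}^0_\rho$ (index $\rho\in\mathbb{R}$) if $\lim_{x\to0_+}f(\lambda x)/f(x)=\lambda^\rho$ for all $\lambda>0$; $\mathrm{RV}^0_{\pm\infty}$ are defined analogously (with $x\to0_+$). Only behaviour near $\infty$ (resp. near $0$) matters: a function belongs to one of these classes if its restriction to some $[a,\infty)$ (resp. $(0,a]$) is positive and belongs to it. Joint Karamata regularity: operators $L_1,\ldots,L_n:\mathcal{E}\to\mathcal{E}$ with $C:=\bigcap_{i=1}^n\mathrm{Fix}\,L_i\ne\emptyset$ are jointly Karamata regular over a bounded set $B$ if there is a function $\psi_B:\mathbb{R}_+\to\mathbb{R}_+$ (a regularity function) such that: (1) $\mathrm{dist}(x,C)\le\psi_B(\max_{1\le i\le n}\|x-L_i(x)\|)$ for all $x\in B$; (2) $\psi_B$ is nondecreasing with $\lim_{t\to0_+}\psi_B(t)=\psi_B(0)=0$; (3) for some $a>0$, $\psi_B|_{(0,a]}\in\mathrm{RV}^0_\rho$ for some $\rho\in[0,1]$. For $n=1$ one says ''Karamata regular''. *)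

(* Defs.v *)
From HB Require Import structures.
From mathcomp Require Export all_boot all_order all_algebra.
From mathcomp Require Export all_classical all_reals all_analysis.
From mathcomp Require Export sesquilinear.
Export Order.TTheory GRing.Theory Num.Theory.
Export numFieldNormedType.Exports.

Set Implicit Arguments.
Unset Strict Implicit.
Unset Printing Implicit Defensive.

Local Open Scope classical_set_scope.
Local Open Scope ring_scope.

(* The norm of E comes from an inner product (a positive definite symmetric
   bilinear form) and E is spanned by finitely many vectors.  The topology, the
   closed, connected and bounded sets are those of the normed module E. *)
Definition euclidean_space (R : realType) (E : normedModType R) : Prop :=
  (exists dot : {dot E for idfun}, forall x : E, `|x| ^+ 2 = dot x x) /\
  (exists n (b : 'I_n -> E), forall x : E,
     exists c : 'I_n -> R, x = \sum_(i < n) c i *: b i).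

Definition Fix (T : Type) (f : T -> T) : set T := [set x | f x = x].

Definition dist (R : realType) (E : normedModType R) (x : E) (C : set E) : R :=
  inf [set `|x - c| | c in C].

Definition nonexpansive (R : realType) (E : normedModType R) (S : E -> E) :=
  forall x y, `|S x - S y| <= `|x - y|.

Definition averaged (R : realType) (E : normedModType R) (alpha : R)
    (T : E -> E) : Prop :=
  exists2 S : E -> E, nonexpansive S &
    forall x, T x = (1 - alpha) *: x + alpha *: S x.

Definition finite_convergence (T : Type) (F : set T) (x : nat -> T) : Prop :=
  exists2 p, F p & exists N, forall k, (N <= k)%N -> x k = p.

(** Regular variation.  Functions are total on R; only their restriction to
    some [a, +oo[ (resp. ]0, a]) matters. *)

Definition posmeas_at_pinfty (R : realType) (f : R -> R) : Prop :=
  exists2 a, 0 < a &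
    (forall x, a <= x -> 0 < f x) /\ measurable_fun `[a, +oo[ f.

Definition posmeas_at0 (R : realType) (f : R -> R) : Prop :=
  exists2 a, 0 < a &
    (forall x, 0 < x <= a -> 0 < f x) /\ measurable_fun `]0, a] f.

Definition RV (R : realType) (rho : R) (f : R -> R) : Prop :=
  posmeas_at_pinfty f /\
  forall lam : R, 0 < lam -> f (lam * x) / f x @[x --> +oo] --> lam `^ rho.

Definition RV_pinfty (R : realType) (f : R -> R) : Prop :=
  [/\ posmeas_at_pinfty f,
      forall lam : R, 0 < lam < 1 -> f (lam * x) / f x @[x --> +oo] --> (0 : R),
      f (1 * x) / f x @[x --> +oo] --> (1 : R) &
      forall lam : R, 1 < lam -> f (lam * x) / f x @[x --> +oo] --> +oo].

Definition RV_ninfty (R : realType) (f : R -> R) : Prop :=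
  RV_pinfty (fun x => (f x)^-1).

Definition RVat0 (R : realType) (rho : R) (f : R -> R) : Prop :=
  posmeas_at0 f /\
  forall lam : R, 0 < lam -> f (lam * x) / f x @[x --> 0^'+] --> lam `^ rho.

Definition RVat0_pinfty (R : realType) (f : R -> R) : Prop :=
  [/\ posmeas_at0 f,
      forall lam : R, 0 < lam < 1 -> f (lam * x) / f x @[x --> 0^'+] --> (0 : R),
      f (1 * x) / f x @[x --> 0^'+] --> (1 : R) &
      forall lam : R, 1 < lam -> f (lam * x) / f x @[x --> 0^'+] --> +oo].

Definition RVat0_ninfty (R : realType) (f : R -> R) : Prop :=
  RVat0_pinfty (fun x => (f x)^-1).

(* psi : R_+ -> R_+ is given as a function on R whose values at negative
   arguments are irrelevant. *)
Definition jointly_karamata_regular (R : realType) (E : normedModType R)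
    (n : nat) (L : 'I_n -> E -> E) (B : set E) (psi : R -> R) : Prop :=
  let C := \bigcap_(i in [set: 'I_n]) Fix (L i) in
  [/\ C !=set0 /\ bounded_set B,
      forall t : R, 0 <= t -> 0 <= psi t,
      forall x, B x -> dist x C <= psi (\big[Num.max/0]_(i < n) `|x - L i x|),
      [/\ forall t u : R, 0 <= t -> t <= u -> psi t <= psi u,
          psi t @[t --> 0^'+] --> (0 : R) & psi 0 = 0] &
      exists2 rho : R, 0 <= rho <= 1 & RVat0 rho psi].

Definition active (R : realType) (m : nat) (w : nat -> 'I_m -> R) (k : nat) :
  {set 'I_m} := [set i | 0 < w k i]%SET.

(* The default value 1 of the minimum is harmless: weights are at most 1 and
   active w k is nonempty as soon as the weights are nonnegative of sum 1. *)
Definition inf_weight (R : realType) (m : nat) (w : nat -> 'I_m -> R) : R :=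
  inf (range (fun k => \big[Num.min/1]_(i in active w k) w k i)).

(* Minus generalized inverse of the restriction of f to ]0, a]. *)
Definition minus_inv (R : realType) (a : R) (f : R -> R) (y : R) : R :=
  sup [set x | 0 < x <= a /\ f x < y].

Definition oriented_integral (R : realType) (f : R -> R) (a b : R) : R :=
  if a <= b then \int[lebesgue_measure]_(t in `[a, b]) f t
  else - \int[lebesgue_measure]_(t in `[b, a]) f t.

Definition phi_hat (R : realType) (alpha nu : R) (s : nat) (psi : R -> R)
    (u : R) : R :=
  psi (Num.sqrt
    (2 * alpha * (1 + 4 * nu * s%:R) / (nu * (1 - alpha)) * u)) ^+ 2.

Definition Phi (R : realType) (a delta : R) (f : R -> R) (u : R) : R :=
  oriented_integral (fun t => (minus_inv a f t)^-1) u delta.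

(* Inverse of g : ]0, +oo[ -> R; it is 0 outside the range of g, hence can only
   be eventually positive when that range contains a neighborhood of +oo. *)
Definition inv_pos (R : realType) (g : R -> R) : R -> R :=
  'pinv_(fun=> 0) `]0, +oo[ g.

(* Main.v *)
(* The function phi is nondecreasing and regularly varying of index rho at 0,
   so phi^- varies with index 1/rho, and the density 1/phi^- of Phi_phi with
   index -1/rho.  The ratio Phi_phi(l u)/Phi_phi(u) then follows that of the
   densities, up to the factor l, because Phi_phi(0+) = +oo.  This divergence
   is a consequence of phi(u) >= c u near 0.  For rho < 1 the latter holds since
   phi(u/2) >= phi(u)/2 eventually.  For rho = 1 it is the only point where the
   algorithm matters: Fejer monotonicity makes the residuals of x^k tend to 0,
   so dist(., F) takes all small positive values on the connected set B, while
   ||b - T_i b|| <= 2 dist(b, F), hence psi_B(2 d) >= d for small d.  Finally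
   ratio limits pass to the inverse of the decreasing function Phi_phi, and
   controlling the ratio at scale 2 yields the comparisons with k^-r. *)
Require Import Defs.
From mathcomp Require Import measurable_realfun ring lra.

Set Implicit Arguments.
Unset Strict Implicit.
Unset Printing Implicit Defensive.

Local Open Scope classical_set_scope.
Local Open Scope ring_scope.

(** Limits of ratios are traded for inequalities between f (k * x) and c * f x near 0, with strict
    room in k and c, and are recovered only at the end. The room is needed twice. [minus_inv] is not
    a true inverse, since psi_B may jump or be flat, so a comparison at one point has to be moved to
    a slightly larger or smaller one. And comparing densities compares functions only up to an
    additive constant, which has to be absorbed. In this form index 0, where 1/rho has no meaning,
    fits the same lemmas: the condition mu^rho < l becomes 1 < l with mu free, which is rapid
    variation. At rho = 1 regular variation alone does not give the divergence: u / log(1/u)^2 has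
    index 1 and is increasing near 0, yet the reciprocal of its inverse is integrable at 0. *)

(** * Filters at 0 and at infinity, monotone functions, comparison of densities *)

Lemma near_at0P (R : realType) (P : R -> Prop) :
  (\forall x \near 0^'+, P x) <-> exists2 d, 0 < d & forall x, 0 < x <= d -> P x.
Proof.
split=> [|[d d0 H]].
  case=> e /= e0 He; exists (e / 2); first by rewrite divr_gt0.
  move=> x /andP[x0 xe]; apply: He => //=.
  by rewrite sub0r normrN gtr0_norm// (le_lt_trans xe)// ltr_pdivrMr// ltr_pMr// ltr1n.
exists d => //= x /=; rewrite sub0r normrN => xd x0; apply: H.
by rewrite x0 ltW// -(gtr0_norm x0).
Qed.

Lemma near_pinftyP (R : realType) (P : R -> Prop) :
  (\forall x \near +oo, P x) <-> exists2 M, 0 < M & forall x, M <= x -> P x.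
Proof.
split=> [[M [_ HM]]|[M M0 HM]].
  exists (Num.max 0 M + 1) => [|x Mx]; first by rewrite ltr_pwDr// le_max lexx.
  by apply: HM; rewrite (lt_le_trans _ Mx)// ltr_pwDr// le_max lexx orbT.
by exists M; split=> [|x /ltW]; [exact: num_real|exact: HM].
Qed.

(** Preimages of rays under a monotone function on an interval are intervals. *)
Lemma nonincreasing_on_measurable (R : realType) (D : set R) (f : R -> R) :
  is_interval D -> {in D &, {homo f : x y /~ x <= y}} -> measurable_fun D f.
Proof.
move=> iD f_ni; have mD : measurable D by exact: is_interval_measurable.
apply: (measurability (@RGenCInfty.G R)) => [|/= _ [_] [r] -> <-].
  exact: RGenCInfty.measurableE.
apply: is_interval_measurable => x y /= [Dx fx] [Dy fy] z /andP[xz zy].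
have Dz : D z by apply: (iD x y) => //; rewrite xz.
split=> //=; move: fy; rewrite !in_itv/= !andbT => /le_trans; apply.
by apply: f_ni => //; exact/mem_set.
Qed.

Lemma cvg_between (R : realType) (T : Type) (G : set_system T) (FG : Filter G)
    (f : T -> R) (l : R) :
  (forall c, l < c -> \forall t \near G, f t <= c) ->
  (forall c, c < l -> \forall t \near G, c <= f t) -> f t @[t --> G] --> l.
Proof.
move=> Hu Hl; apply/cvgrPdist_le => e e0.
have l1 : l < l + e by rewrite ltrDl.
have l2 : l - e < l by rewrite gtrBl.
apply: filterS2 (Hu _ l1) (Hl _ l2) => t h1 h2.
by rewrite ler_norml; apply/andP; split; lra.
Qed.

(** An integrated form of Phi' = - g on []0, t0]]: the increment lies between the lower and upper
    rectangles of a nonincreasing g. It determines Phi there up to a constant. The bound t0 allows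
    two densities to be compared only near 0. *)
Definition density_on (R : realType) (t0 : R) (g Phi : R -> R) :=
  forall u v, 0 < u -> u <= v -> v <= t0 ->
    (v - u) * g v <= Phi u - Phi v <= (v - u) * g u.

(* Since Phi1 and Phi2 are only known through these rectangle bounds, the
   comparison of densities gives the inequality up to an error, which repeated
   bisection of [u, v] makes vanish. *)
Lemma density_le (R : realType) (t0 : R) (g1 g2 Phi1 Phi2 : R -> R) :
  density_on t0 g1 Phi1 -> density_on t0 g2 Phi2 ->
  (forall t, 0 < t <= t0 -> g1 t <= g2 t) ->
  forall u v, 0 < u -> u <= v -> v <= t0 -> Phi1 u - Phi1 v <= Phi2 u - Phi2 v.
Proof.
move=> d1 d2 g12.
have step n : forall u v, 0 < u -> u <= v -> v <= t0 ->
    Phi1 u - Phi1 v <= Phi2 u - Phi2 v + (v - u) * (g2 u - g2 v) / 2 ^+ n.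
  elim: n => [|n IH] u v u0 uv vt.
    rewrite expr0 divr1.
    have /andP[_ h1] := d1 _ _ u0 uv vt; have /andP[h2 _] := d2 _ _ u0 uv vt.
    have gu : g1 u <= g2 u by apply: g12; rewrite u0 (le_trans uv).
    have : (v - u) * g1 u <= (v - u) * g2 u by rewrite ler_wpM2l// subr_ge0.
    lra.
  have um : u <= (u + v) / 2 by lra.
  have mv : (u + v) / 2 <= v by lra.
  have m0 : 0 < (u + v) / 2 by lra.
  have h1 := IH _ _ u0 um (le_trans mv vt).
  have h2 := IH _ _ m0 mv vt.
  have e1 : (u + v) / 2 - u = (v - u) / 2 by lra.
  have e2 : v - (u + v) / 2 = (v - u) / 2 by lra.
  rewrite e1 in h1; rewrite e2 in h2.
  (* The drops of g2 over the two halves add up to its drop over [u, v], while the width is halved: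
     this is where the extra factor 1/2 comes from. *)
  have -> : (v - u) * (g2 u - g2 v) / 2 ^+ n.+1 =
    (v - u) / 2 * (g2 u - g2 ((u + v) / 2)) / 2 ^+ n +
    (v - u) / 2 * (g2 ((u + v) / 2) - g2 v) / 2 ^+ n.
    by rewrite exprS; field; rewrite expf_neq0.
  lra.
move=> u v u0 uv vt; apply/ler_addgt0Pr => e e0.
have [n ne] : exists n, (v - u) * (g2 u - g2 v) / 2 ^+ n <= e.
  set K := _ * _.
  have [n Kn] : exists n : nat, K / e <= n%:R.
    exists (Num.bound `|K / e|); rewrite (le_trans (ler_norm _))// ltW//.
    exact: archi_boundP.
  exists n; rewrite ler_pdivrMr ?exprn_gt0// mulrC -ler_pdivrMr//.
  by rewrite (le_trans Kn)// -natrX ler_nat ltnW// ltn_expl.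
by apply: (le_trans (step n _ _ u0 uv vt)); rewrite lerD2l.
Qed.

(** * Minus generalized inverses *)

Lemma powR_continuous (R : realType) (p x : R) :
  0 < x -> y `^ p @[y --> x] --> x `^ p.
Proof.
move=> x0; have /derivable1_diffP h : derivable (powR (R:=R) ^~ p) x 1.
  by have [] := is_derive1_powR p x0.
exact: (differentiable_continuous h).
Qed.

Lemma powR_lt_left (R : realType) (p l x : R) :
  0 < x -> l < x `^ p -> exists2 y, 0 < y < x & l < y `^ p.
Proof.
move=> x0 lx.
have : \forall y \near x^'-, [/\ y < x, 0 < y & l < y `^ p].
  near=> y; split.
  - by near: y; exact: nbhs_left_lt.
  - by near: y; exact: nbhs_left_gt.
  - near: y; apply: (cvgr_gt (x `^ p)) => //.
    by apply: cvg_at_left_filter; exact: powR_continuous.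
by move=> /filter_ex[y [yx y0 ly]]; exists y => //; rewrite y0.
Unshelve. all: by end_near.
Qed.

Lemma powR_lt_right (R : realType) (p l x : R) :
  0 < x -> x `^ p < l -> exists2 y, x < y & y `^ p < l.
Proof.
move=> x0 lx.
have : \forall y \near x^'+, x < y /\ y `^ p < l.
  near=> y; split.
  - by near: y; exact: nbhs_right_gt.
  - near: y; apply: (cvgr_lt (x `^ p)) => //.
    by apply: cvg_at_right_filter; exact: powR_continuous.
by move=> /filter_ex[y [yx ly]]; exists y.
Unshelve. all: by end_near.
Qed.

(** Stated on the whole of []0, +oo[], so that f can be evaluated without checking that the argument
    is at most a. Neither continuity nor strict monotonicity is included; the limit 0 makes the set
    defining [minus_inv] nonempty for every y > 0. *)
Definition gauge (R : realType) (f : R -> R) :=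
  [/\ forall x, 0 < x -> 0 < f x,
      forall x y, 0 < x -> x <= y -> f x <= f y &
      f x @[x --> 0^'+] --> (0 : R)].

Lemma minus_inv_has_sup (R : realType) (a : R) (f : R -> R) (y : R) :
  gauge f -> 0 < a -> 0 < y -> has_sup [set x | 0 < x <= a /\ f x < y].
Proof.
move=> [_ _ f0] a0 y0; split; last by exists a => x [/andP[]].
have : \forall x \near (0 : R)^'+, [/\ 0 < x, x <= a & f x < y].
  near=> x; split.
  - by near: x; exact: nbhs_right_gt.
  - by near: x; exact: nbhs_right_le.
  - by near: x; exact: (cvgr_lt (0 : R)).
by move=> /filter_ex[x [x0 xa fx]]; exists x; rewrite /= x0.
Unshelve. all: by end_near.
Qed.

Lemma minus_inv_ge (R : realType) (a : R) (f : R -> R) (x y : R) :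
  gauge f -> 0 < a -> 0 < y -> 0 < x <= a -> f x < y -> x <= minus_inv a f y.
Proof.
by move=> gf a0 y0 xa fx; apply: sup_upper_bound => //; exact: minus_inv_has_sup.
Qed.

Lemma minus_inv_le (R : realType) (a : R) (f : R -> R) (x y : R) :
  gauge f -> 0 < a -> 0 < x -> 0 < y -> y <= f x -> minus_inv a f y <= x.
Proof.
move=> gf a0 x0 y0 fx; apply: ge_sup; first by case: (minus_inv_has_sup gf a0 y0).
move=> z [/andP[z0 za] fz]; rewrite leNgt; apply/negP => xz.
have [_ fnd _] := gf.
by move: fz; rewrite ltNge (le_trans fx)// fnd// ltW.
Qed.

Lemma minus_inv_gt0 (R : realType) (a : R) (f : R -> R) (y : R) :
  gauge f -> 0 < a -> 0 < y -> 0 < minus_inv a f y.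
Proof.
move=> gf a0 y0; have [[x [xa fx]] _] := minus_inv_has_sup gf a0 y0.
by apply: (lt_le_trans _ (minus_inv_ge gf a0 y0 xa fx)); case/andP: xa.
Qed.

Lemma minus_inv_nondecreasing (R : realType) (a : R) (f : R -> R) (y z : R) :
  gauge f -> 0 < a -> 0 < y -> y <= z -> minus_inv a f y <= minus_inv a f z.
Proof.
move=> gf a0 y0 yz; apply: ge_sup; first by case: (minus_inv_has_sup gf a0 y0).
move=> x [xa fx]; apply: minus_inv_ge => //; first exact: lt_le_trans yz.
exact: lt_le_trans yz.
Qed.

Lemma le_minus_inv (R : realType) (a : R) (f : R -> R) (x y : R) :
  gauge f -> 0 < a -> 0 < y -> minus_inv a f y < x -> x <= a -> y <= f x.
Proof.
move=> gf a0 y0 yx xa; rewrite leNgt; apply/negP => fx.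
have x0 : 0 < x by rewrite (lt_trans _ yx)// minus_inv_gt0.
by move: yx; rewrite ltNge minus_inv_ge// x0.
Qed.

Lemma lt_minus_inv (R : realType) (a : R) (f : R -> R) (x y : R) :
  gauge f -> 0 < a -> 0 < x -> 0 < y -> x < minus_inv a f y -> f x < y.
Proof.
by move=> gf a0 x0 y0 xy; rewrite ltNge; apply/negP => /(minus_inv_le gf a0 x0 y0);
  rewrite leNgt xy.
Qed.

Lemma minus_inv_near0 (R : realType) (a e : R) (f : R -> R) :
  gauge f -> 0 < a -> 0 < e -> \forall y \near 0^'+, minus_inv a f y <= e.
Proof.
move=> gf a0 e0; near=> y; have y0 : 0 < y by near: y; exact: nbhs_right_gt.
apply: minus_inv_le => //; near: y; apply: nbhs_right_le.
by case: gf => + _ _; apply.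
Unshelve. all: by end_near.
Qed.

(** At x = f^-(y) itself f may jump, so f x cannot be bounded below by y. The slightly larger point
    x * (mu / k) can be used instead, where k < mu still satisfies l < k^rho: there f is at least y,
    and scaling by k leads to mu * x, where f is at least l * y. For rho = 0 the condition is l < 1
    and mu is arbitrary. *)
Lemma minus_inv_ratio_le (R : realType) (a rho l mu : R) (f : R -> R) :
  gauge f -> 0 < a -> 0 < l -> 0 < mu ->
  (forall k, 0 < k -> f (k * x) / f x @[x --> 0^'+] --> k `^ rho) ->
  l < mu `^ rho -> \forall y \near 0^'+, minus_inv a f (l * y) <= mu * minus_inv a f y.
Proof.
move=> gf a0 l0 mu0 frho lmu.
have [k /andP[k0 kmu] lk] := powR_lt_left mu0 lmu.
have /near_at0P[d d0 Hd] : \forall x \near 0^'+, l < f (k * x) / f x.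
  exact: cvgr_gt (frho _ k0) _ lk.
have eta1 : 1 < mu / k by rewrite ltr_pdivlMr// mul1r.
have eta0 : 0 < mu / k by rewrite divr_gt0.
(* The bound d brings x * (mu / k) into the range of the ratio estimate, the bound a into the domain
   of the generalized inverse. *)
have /near_at0P[d' d'0 Hd'] : \forall y \near 0^'+,
    minus_inv a f y <= Num.min d a / (mu / k).
  by apply: minus_inv_near0 => //; rewrite divr_gt0// lt_min d0.
apply/near_at0P; exists d' => // y yd; have /andP[y0 _] := yd.
have [fpos _ _] := gf.
set x := minus_inv a f y; have x0 : 0 < x by exact: minus_inv_gt0.
have := Hd' _ yd; rewrite -/x ler_pdivlMr// le_min => /andP[xd xa].
have ex0 : 0 < x * (mu / k) by rewrite mulr_gt0.
have h1 : y <= f (x * (mu / k)).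
  by apply: (le_minus_inv gf a0 y0) => //; rewrite -/x ltr_pMr.
have h2 := Hd (x * (mu / k)); rewrite ex0 xd in h2.
have {}h2 := h2 isT.
rewrite ltr_pdivlMr ?fpos// in h2.
apply: minus_inv_le => //; first exact: mulr_gt0.
  exact: mulr_gt0.
have -> : mu * x = k * (x * (mu / k)) by field; rewrite gt_eqF.
by rewrite (le_trans _ (ltW h2))// ler_wpM2l// ltW.
Qed.

(** Mirror argument: k > mu with k^rho < l, and the test point x * (mu / k) lies strictly below
    f^-(y), where f is less than y. *)
Lemma minus_inv_ratio_ge (R : realType) (a rho l mu : R) (f : R -> R) :
  gauge f -> 0 < a -> 0 < l -> 0 < mu ->
  (forall k, 0 < k -> f (k * x) / f x @[x --> 0^'+] --> k `^ rho) ->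
  mu `^ rho < l -> \forall y \near 0^'+, mu * minus_inv a f y <= minus_inv a f (l * y).
Proof.
move=> gf a0 l0 mu0 frho lmu.
have [k kmu lk] := powR_lt_right mu0 lmu.
have k0 : 0 < k by exact: lt_trans kmu.
have /near_at0P[d d0 Hd] : \forall x \near 0^'+, f (k * x) / f x < l.
  exact: cvgr_lt (frho _ k0) _ lk.
have eta1 : mu / k < 1 by rewrite ltr_pdivrMr// mul1r.
have eta0 : 0 < mu / k by rewrite divr_gt0.
(* Here the bound a / mu keeps mu * x in []0, a]], as needed to bound the supremum from below. *)
have /near_at0P[d' d'0 Hd'] : \forall y \near 0^'+,
    minus_inv a f y <= Num.min (d / (mu / k)) (a / mu).
  by apply: minus_inv_near0 => //; rewrite lt_min !divr_gt0.
apply/near_at0P; exists d' => // y yd; have /andP[y0 _] := yd.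
have [fpos _ _] := gf.
set x := minus_inv a f y; have x0 : 0 < x by exact: minus_inv_gt0.
have := Hd' _ yd; rewrite -/x le_min => /andP[]; rewrite !ler_pdivlMr// => xd xa.
have ex0 : 0 < x * (mu / k) by rewrite mulr_gt0.
have h1 : f (x * (mu / k)) < y.
  by apply: (lt_minus_inv gf a0 ex0 y0) => //; rewrite -/x gtr_pMr.
have h2 := Hd (x * (mu / k)); rewrite ex0 xd in h2.
have {}h2 := h2 isT.
rewrite ltr_pdivrMr ?fpos// in h2.
apply: minus_inv_ge => //.
  exact: mulr_gt0.
  by rewrite mulr_gt0//= mulrC.
have -> : mu * x = k * (x * (mu / k)) by field; rewrite gt_eqF.
by rewrite (lt_trans h2)// ltr_pM2l.
Qed.

(** A linear lower bound at 2 * u passes to u by the halving hypothesis. The slope is chosen so that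
    c * d = f d / 2: on []d / 2, d]], where doubling would leave the range, f u >= f (d / 2) >= f d
    / 2 = c * d >= c * u. *)
Lemma gauge_ge_linear (R : realType) (f : R -> R) :
  gauge f -> (\forall u \near 0^'+, f u / 2 <= f (u / 2)) ->
  exists2 c, 0 < c & \forall u \near 0^'+, c * u <= f u.
Proof.
move=> [fpos fnd _] /near_at0P[d d0 Hd].
have fd := fpos _ d0.
exists (f d / 2 / d); first by rewrite !divr_gt0.
set c := _ / d; have c0 : 0 < c by rewrite !divr_gt0.
have cd : c * d = f d / 2 by rewrite /c divfK// gt_eqF.
have step n : forall u, d / 2 ^+ n <= u -> u <= d -> c * u <= f u.
  elim: n => [|n IH] u.
    by rewrite expr0 divr1 => du ud; have -> : u = d by [apply/le_anti/andP]; lra.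
  move=> du ud; have u0 : 0 < u by rewrite (lt_le_trans _ du)// divr_gt0// exprn_gt0.
  have [u2|u2] := leP (2 * u) d.
    have h1 : c * (2 * u) <= f (2 * u).
      apply: IH => //; move: du; rewrite exprS !ler_pdivrMr ?mulr_gt0 ?exprn_gt0//.
      lra.
    have := Hd (2 * u); rewrite u2 mulr_gt0//= => /(_ isT).
    have -> : 2 * u / 2 = u by field.
    lra.
  have := Hd d; rewrite d0 lexx => /(_ isT) h.
  have h' : f (d / 2) <= f u by apply: fnd; [rewrite divr_gt0|lra].
  have h2 : c * u <= c * d by rewrite ler_pM2l.
  lra.
apply/near_at0P; exists d => // u /andP[u0 ud].
have [n dn] : exists n : nat, d / u <= n%:R.
  exists (Num.bound `|d / u|); rewrite (le_trans (ler_norm _))// ltW//.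
  exact: archi_boundP.
apply: (step n) => //; rewrite ler_pdivrMr ?exprn_gt0// mulrC -ler_pdivrMr//.
by rewrite (le_trans dn)// -natrX ler_nat ltnW// ltn_expl.
Qed.

Lemma minus_inv_le_linear (R : realType) (a c : R) (f : R -> R) :
  gauge f -> 0 < a -> 0 < c -> (\forall u \near 0^'+, c * u <= f u) ->
  \forall y \near 0^'+, minus_inv a f y <= y / c.
Proof.
move=> gf a0 c0 /near_at0P[d d0 Hd]; apply/near_at0P; exists (d * c).
  exact: mulr_gt0.
move=> y /andP[y0 yd]; apply: minus_inv_le => //; first exact: divr_gt0.
have := Hd (y / c); rewrite divr_gt0// ler_pdivrMr// yd => /(_ isT).
by rewrite mulrCA divff ?gt_eqF// mulr1.
Qed.

(** * Functions given by a nonincreasing density *)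

Definition posmono (R : realType) (g : R -> R) :=
  (forall t, 0 < t -> 0 < g t) /\ (forall s t, 0 < s -> s <= t -> g t <= g s).

Lemma posmono_minus_inv (R : realType) (a : R) (f : R -> R) :
  gauge f -> 0 < a -> posmono (fun t => (minus_inv a f t)^-1).
Proof.
move=> gf a0; split=> [t t0|s t s0 st]; first by rewrite invr_gt0 minus_inv_gt0.
have t0 := lt_le_trans s0 st.
by rewrite lef_pV2 ?posrE ?minus_inv_gt0// minus_inv_nondecreasing.
Qed.

Lemma posmono_integrable (R : realType) (g : R -> R) (u v : R) :
  posmono g -> 0 < u ->
  lebesgue_measure.-integrable `[u, v] (EFin \o g).
Proof.
move=> [gpos gni] u0; apply: measurable_bounded_integrable => //=.
- by rewrite lebesgue_measure_itv/=; case: ifP => // _; rewrite -EFinD ltry.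
- apply: nonincreasing_on_measurable; first exact: interval_is_interval.
  move=> x y; rewrite !inE/= !in_itv/= => _ /andP[uy _] yx.
  by apply: gni => //; exact: lt_le_trans u0 uy.
- exists (g u); split; first exact: num_real.
  move=> M gM x; rewrite /= in_itv/= => /andP[ux _].
  by rewrite ger0_norm ?ltW ?gpos ?(lt_le_trans u0)// (le_lt_trans _ gM)// gni.
Qed.

Lemma posmono_integral_bounds (R : realType) (g : R -> R) (u v : R) :
  posmono g -> 0 < u -> u <= v ->
  (v - u) * g v <= \int[lebesgue_measure]_(t in `[u, v]) g t <= (v - u) * g u.
Proof.
move=> pg u0 uv; have [gpos gni] := pg.
have cstE (c : R) : \int[lebesgue_measure]_(t in `[u, v]) c = (v - u) * c.
  rewrite Rintegral_cst//= lebesgue_measure_itv/= lte_fin mulrC.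
  by case: ltP => //= vu; have -> : v = u by [apply/le_anti/andP]; rewrite subrr.
have icst (c : R) : lebesgue_measure.-integrable `[u, v] (EFin \o cst c).
  apply: measurable_bounded_integrable => //=.
    by rewrite lebesgue_measure_itv/=; case: ifP => // _; rewrite -EFinD ltry.
  by exists `|c|; split; [exact: num_real|move=> M cM x _ /=; exact: ltW].
have ig := posmono_integrable v pg u0.
rewrite -!cstE; apply/andP; split.
  apply: le_Rintegral => // [|x]; first exact: icst.
  by rewrite /= in_itv/= => /andP[ux xv]; apply: gni => //; exact: lt_le_trans u0 ux.
apply: le_Rintegral => // [|x]; first exact: icst.
by rewrite /= in_itv/= => /andP[ux xv]; apply: gni.
Qed.

Lemma posmono_integral_split (R : realType) (g : R -> R) (u m v : R) :
  posmono g -> 0 < u -> u <= m -> m <= v ->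
  \int[lebesgue_measure]_(t in `[u, v]) g t =
  \int[lebesgue_measure]_(t in `[u, m]) g t +
  \int[lebesgue_measure]_(t in `[m, v]) g t.
Proof.
move=> pg u0 um mv.
have ig := posmono_integrable v pg u0.
rewrite -(@Rintegral_itv_obnd_cbnd _ m); last first.
  apply: integrableS (posmono_integrable v pg (lt_le_trans u0 um)) => //.
  exact: subset_itv_oc_cc.
rewrite -(@Rintegral_itvB _ g (BLeft u) (BRight v) m) ?bnd_simp//.
by rewrite addrCA subrr addr0.
Qed.

(** The bridge from the Lebesgue integral to rectangle bounds, the only form in which it is used
    afterwards. Of the four positions of u and v relative to delta, one contradicts u <= v. *)
Lemma oriented_integral_density (R : realType) (g : R -> R) (delta t0 : R) :
  posmono g -> 0 < delta ->
  density_on t0 g (fun u => oriented_integral g u delta).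
Proof.
move=> pg d0 u v u0 uv _; have v0 := lt_le_trans u0 uv.
suff -> : oriented_integral g u delta - oriented_integral g v delta =
    \int[lebesgue_measure]_(t in `[u, v]) g t by exact: posmono_integral_bounds.
rewrite /oriented_integral; case: (leP u delta) => ud; case: (leP v delta) => vd.
- by rewrite (posmono_integral_split pg u0 uv vd) addrK.
- by rewrite (posmono_integral_split pg u0 ud (ltW vd)) opprK.
- by have := lt_le_trans ud uv; rewrite ltNge vd.
- by rewrite (posmono_integral_split pg d0 (ltW ud) uv) opprK addKr.
Qed.

Lemma density_decreasing (R : realType) (g Phi : R -> R) (u v : R) :
  posmono g -> (forall t0, density_on t0 g Phi) -> 0 < u -> u < v -> Phi v < Phi u.
Proof.
move=> [gpos _] dPhi u0 uv.
have /andP[h _] := dPhi v u v u0 (ltW uv) (lexx v).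
have : 0 < (v - u) * g v by rewrite mulr_gt0 ?gpos ?subr_gt0// (lt_trans u0).
lra.
Qed.

Lemma density_nonincreasing (R : realType) (g Phi : R -> R) (u v : R) :
  posmono g -> (forall t0, density_on t0 g Phi) -> 0 < u -> u <= v -> Phi v <= Phi u.
Proof.
move=> pg dPhi u0; rewrite le_eqVlt => /predU1P[->//|uv].
exact/ltW/(density_decreasing pg dPhi).
Qed.

(** As for the harmonic series: on [u / 2, u] the density is at least c / u, so every halving of u
    adds at least c / 2. *)
Lemma density_pinfty (R : realType) (g Phi : R -> R) (c : R) :
  posmono g -> (forall t0, density_on t0 g Phi) ->
  0 < c -> (\forall t \near 0^'+, c / t <= g t) -> Phi u @[u --> 0^'+] --> +oo.
Proof.
move=> pg dPhi c0 /near_at0P[d d0 Hd]; apply/cvgryPge => A.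
have pn n : 0 < d / 2 ^+ n :> R by rewrite divr_gt0// exprn_gt0.
have step n : Phi d + n%:R * (c / 2) <= Phi (d / 2 ^+ n).
  elim: n => [|n IH]; first by rewrite mul0r addr0 expr0 divr1.
  have e : d / 2 ^+ n.+1 = (d / 2 ^+ n) / 2.
    by rewrite exprS; field; rewrite expf_neq0.
  set u := d / 2 ^+ n in IH e *; have u0 : 0 < u := pn n.
  have u2 : 0 < u / 2 by rewrite divr_gt0.
  have uu : u / 2 <= u by lra.
  have /andP[h _] := dPhi u (u / 2) u u2 uu (lexx u).
  have ud : u <= d.
    by rewrite /u ler_pdivrMr ?exprn_gt0// ler_peMr ?(ltW d0)// exprn_ege1// ler1n.
  have := Hd u; rewrite u0 ud => /(_ isT).
  rewrite ler_pdivrMr// => h2.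
  have e2 : (u - u / 2) * g u = g u * u / 2 by field.
  rewrite e2 in h; rewrite e -natr1; lra.
pose n := Num.bound `|(A - Phi d) / (c / 2)|.
have hn : A <= Phi (d / 2 ^+ n).
  apply: le_trans (step n); rewrite -lerBlDl -ler_pdivrMr ?divr_gt0//.
  by rewrite (le_trans (ler_norm _))// ltW// archi_boundP.
apply/near_at0P; exists (d / 2 ^+ n) => // u /andP[u0 ud].
by rewrite (le_trans hn)// (density_nonincreasing pg dPhi).
Qed.

Lemma density_onM (R : realType) (g Phi : R -> R) (k t0 : R) :
  0 <= k -> density_on t0 g Phi ->
  density_on t0 (fun t => k * g t) (fun t => k * Phi t).
Proof.
move=> k0 dPhi u v u0 uv vt; have /andP[h1 h2] := dPhi u v u0 uv vt.
by rewrite -mulrBr ![_ * (k * _)]mulrCA !ler_wpM2l.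
Qed.

Lemma density_on_scale (R : realType) (g Phi : R -> R) (l t0 : R) :
  0 < l -> density_on (l * t0) g Phi ->
  density_on t0 (fun t => l * g (l * t)) (fun t => Phi (l * t)).
Proof.
move=> l0 dPhi u v u0 uv vt.
have := dPhi (l * u) (l * v); rewrite mulr_gt0// !ler_pM2l// => /(_ isT uv vt).
by rewrite -mulrBr ![_ * (l * _)]mulrCA -!mulrA.
Qed.

(** The substitution t -> l * t turns the comparison of densities into one of the increments of Phi
    (l * u) and l * k * Phi u from u to d. The values at d are constants, absorbed by (C - l * k) *
    Phi u once Phi u is large. *)
Lemma density_scale_le (R : realType) (g Phi : R -> R) (l k C : R) :
  (forall t0, density_on t0 g Phi) -> Phi u @[u --> 0^'+] --> +oo ->
  0 < l -> 0 < k -> (\forall t \near 0^'+, g (l * t) <= k * g t) -> l * k < C ->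
  \forall u \near 0^'+, Phi (l * u) <= C * Phi u.
Proof.
move=> dPhi Phioo l0 k0 /near_at0P[d d0 Hd] lkC.
have lk0 : 0 < l * k by rewrite mulr_gt0.
have cmp u : 0 < u -> u <= d ->
    Phi (l * u) - Phi (l * d) <= l * k * Phi u - l * k * Phi d.
  move=> u0 ud.
  apply: (density_le (density_on_scale l0 (dPhi _)) (density_onM (ltW lk0) (dPhi d))) => //.
  by move=> t td; rewrite -mulrA ler_pM2l// Hd.
near=> u.
have u0 : 0 < u by near: u; exact: nbhs_right_gt.
have ud : u <= d by near: u; exact: nbhs_right_le.
have h := cmp u u0 ud.
have : (Phi (l * d) - l * k * Phi d) / (C - l * k) <= Phi u.
  by near: u; move/cvgryPge: Phioo; apply.
rewrite ler_pdivrMr ?subr_gt0//; lra.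
Unshelve. all: by end_near.
Qed.

Lemma density_scale_ge (R : realType) (g Phi : R -> R) (l k C : R) :
  (forall t0, density_on t0 g Phi) -> Phi u @[u --> 0^'+] --> +oo ->
  0 < l -> 0 < k -> (\forall t \near 0^'+, k * g t <= g (l * t)) -> C < l * k ->
  \forall u \near 0^'+, C * Phi u <= Phi (l * u).
Proof.
move=> dPhi Phioo l0 k0 /near_at0P[d d0 Hd] lkC.
have lk0 : 0 < l * k by rewrite mulr_gt0.
have cmp u : 0 < u -> u <= d ->
    l * k * Phi u - l * k * Phi d <= Phi (l * u) - Phi (l * d).
  move=> u0 ud.
  apply: (density_le (density_onM (ltW lk0) (dPhi d)) (density_on_scale l0 (dPhi _))) => //.
  by move=> t td; rewrite -mulrA ler_pM2l// Hd.
near=> u.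
have u0 : 0 < u by near: u; exact: nbhs_right_gt.
have ud : u <= d by near: u; exact: nbhs_right_le.
have h := cmp u u0 ud.
have : (l * k * Phi d - Phi (l * d)) / (l * k - C) <= Phi u.
  by near: u; move/cvgryPge: Phioo; apply.
rewrite ler_pdivrMr ?subr_gt0//; lra.
Unshelve. all: by end_near.
Qed.

Lemma powR_lt_neg (R : realType) (p x y : R) :
  p < 0 -> 0 < x -> x < y -> y `^ p < x `^ p.
Proof.
move=> p0 x0 xy; have y0 := lt_trans x0 xy.
rewrite -(opprK p) !(powRN _ (- p)) ltf_pV2 ?posrE ?powR_gt0//.
by apply: gt0_ltr_powR; rewrite ?oppr_gt0// nnegrE ltW.
Qed.

Lemma powRK (R : realType) (p x : R) : 0 < x -> p != 0 -> (x `^ p^-1) `^ p = x.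
Proof. by move=> x0 p0; rewrite -powRrM mulVf// powRr1// ltW. Qed.

Lemma gt1_ltr_powR (R : realType) (a p q : R) : 1 < a -> p < q -> a `^ p < a `^ q.
Proof.
move=> a1 pq; have a0 := lt_trans ltr01 a1.
rewrite -(subrK p q) powRD; last by apply/implyP => _; rewrite gt_eqF.
rewrite ltr_pMl ?powR_gt0//; have <- : 1 `^ (q - p) = 1 :> R by rewrite powR1.
by apply: gt0_ltr_powR; rewrite ?subr_gt0// nnegrE// ltW.
Qed.

(** * Regular variation and continuity of functions with density 1/f^- *)

(** The limit clause of [RVat0], separated from positivity and measurability. *)
Definition Karamata_ratio (R : realType) (f : R -> R) (rho : R) :=
  forall k, 0 < k -> f (k * x) / f x @[x --> 0^'+] --> k `^ rho.

(** Reciprocals reverse the estimate on f^-, so the density scales by at most 1 / mu and its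
    primitive by about l / mu. Keeping mu as a parameter, instead of l^(1/rho), covers rho = 0. *)
Lemma inv_minus_inv_scale_le (R : realType) (a rho l mu C : R) (f Phi : R -> R) :
  gauge f -> 0 < a -> Karamata_ratio f rho ->
  (forall t0, density_on t0 (fun t => (minus_inv a f t)^-1) Phi) ->
  Phi u @[u --> 0^'+] --> +oo ->
  0 < l -> 0 < mu -> mu `^ rho < l -> l / mu < C ->
  \forall u \near 0^'+, Phi (l * u) <= C * Phi u.
Proof.
move=> gf a0 frho dPhi Phioo l0 mu0 mul lC.
apply: (density_scale_le dPhi Phioo l0 _ _ lC); first by rewrite invr_gt0.
have /near_at0P[d d0 Hd] := minus_inv_ratio_ge gf a0 l0 mu0 frho mul.
apply/near_at0P; exists d => // t td; have /andP[t0 _] := td.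
rewrite -invfM lef_pV2 ?posrE ?mulr_gt0 ?minus_inv_gt0//.
  exact: Hd.
exact: mulr_gt0.
Qed.

Lemma inv_minus_inv_scale_ge (R : realType) (a rho l mu C : R) (f Phi : R -> R) :
  gauge f -> 0 < a -> Karamata_ratio f rho ->
  (forall t0, density_on t0 (fun t => (minus_inv a f t)^-1) Phi) ->
  Phi u @[u --> 0^'+] --> +oo ->
  0 < l -> 0 < mu -> l < mu `^ rho -> C < l / mu ->
  \forall u \near 0^'+, C * Phi u <= Phi (l * u).
Proof.
move=> gf a0 frho dPhi Phioo l0 mu0 mul lC.
apply: (density_scale_ge dPhi Phioo l0 _ _ lC); first by rewrite invr_gt0.
have /near_at0P[d d0 Hd] := minus_inv_ratio_le gf a0 l0 mu0 frho mul.
apply/near_at0P; exists d => // t td; have /andP[t0 _] := td.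
rewrite -invfM lef_pV2 ?posrE ?mulr_gt0 ?minus_inv_gt0//.
  exact: Hd.
exact: mulr_gt0.
Qed.

Lemma near0_gt0 (R : realType) (f : R -> R) :
  f t @[t --> 0^'+] --> +oo -> \forall t \near 0^'+, 0 < f t.
Proof. by move/cvgryPge => /(_ 1); apply: filterS => t; exact: lt_le_trans. Qed.

(** The critical value of mu is k = l^(1/rho), for which l / k = l^(1 - 1/rho). Any C different from
    this limit leaves room for a mu on the correct side of k. *)
Lemma Karamata_ratio_integral (R : realType) (a rho : R) (f Phi : R -> R) :
  gauge f -> 0 < a -> 0 < rho -> Karamata_ratio f rho ->
  (forall t0, density_on t0 (fun t => (minus_inv a f t)^-1) Phi) ->
  Phi u @[u --> 0^'+] --> +oo -> Karamata_ratio Phi (1 - 1 / rho).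
Proof.
move=> gf a0 rho0 frho dPhi Phioo l l0.
have -> : l `^ (1 - 1 / rho) = l / l `^ rho^-1.
  rewrite powRB; last by apply/implyP => _; rewrite gt_eqF.
  by rewrite powRr1 ?ltW// div1r.
set k := l `^ rho^-1; have k0 : 0 < k by exact: powR_gt0.
have kl : k `^ rho = l by rewrite powRK// gt_eqF.
have Phi0 := near0_gt0 Phioo.
apply: cvg_between => C lC.
  have C0 : 0 < C by apply: lt_trans lC; exact: divr_gt0.
  have lCk : l / C < k by rewrite ltr_pdivrMr// mulrC -ltr_pdivrMr.
  (* The midpoint serves as mu: mu < k gives mu^rho < l, and mu > l / C gives l / mu < C. *)
  have m1 : l / C < (l / C + k) / 2 by lra.
  have m2 : (l / C + k) / 2 < k by lra.
  have m0 : 0 < (l / C + k) / 2 by rewrite (lt_trans _ m1)// divr_gt0.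
  have H : \forall u \near 0^'+, Phi (l * u) <= C * Phi u.
    apply: (inv_minus_inv_scale_le gf a0 frho dPhi Phioo l0 m0).
      by rewrite -[ltRHS]kl; apply: gt0_ltr_powR; rewrite // nnegrE ltW.
    by rewrite ltr_pdivrMr// mulrC -ltr_pdivrMr.
  near=> u; rewrite ler_pdivrMr; [by near: u; exact: H|by near: u; exact: Phi0].
have [m km lm] : exists2 m, k < m & C < l / m.
  (* For C <= 0 the quotient l / C gives no upper limit for mu, and any m > k will do. *)
  have [C0|C0] := leP C 0.
    exists (k + 1); first by rewrite ltrDl.
    by rewrite (le_lt_trans C0)// divr_gt0// addr_gt0.
  have kC : k < l / C by rewrite ltr_pdivlMr// mulrC -ltr_pdivlMr.
  have m1 : k < (l / C + k) / 2 by lra.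
  exists ((l / C + k) / 2) => //; have m0 := lt_trans k0 m1.
  by rewrite ltr_pdivlMr// mulrC -ltr_pdivlMr//; lra.
have m0 := lt_trans k0 km.
have H : \forall u \near 0^'+, C * Phi u <= Phi (l * u).
  apply: (inv_minus_inv_scale_ge gf a0 frho dPhi Phioo l0 m0) => //.
  by rewrite -[ltLHS]kl; apply: gt0_ltr_powR; rewrite // nnegrE ltW.
near=> u; rewrite ler_pdivlMr; [by near: u; exact: H|by near: u; exact: Phi0].
Unshelve. all: by end_near.
Qed.

(** Phi is Lipschitz on []x / 2, +oo[] with constant g (x / 2), by the upper rectangle bound. *)
Lemma density_continuous (R : realType) (g Phi : R -> R) (a b : R) :
  posmono g -> (forall t0, density_on t0 g Phi) -> 0 < a ->
  {within `[a, b], continuous Phi}.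
Proof.
move=> [gpos gni] dPhi a0.
apply: continuous_in_subspaceT => x; rewrite inE/= in_itv/= => /andP[ax _].
have x0 : 0 < x by exact: lt_le_trans ax.
have x2 : 0 < x / 2 by rewrite divr_gt0.
have xx : x / 2 < x by lra.
apply/cvgrPdist_le => e e0; have gx := gpos _ x2.
near=> y.
have y2 : x / 2 < y by near: y; exact: (cvgr_gt x).
have xy : `|x - y| * g (x / 2) <= e.
  rewrite -ler_pdivlMr//; near: y; apply: cvgr_dist_le; first exact: cvg_id.
  exact: divr_gt0.
apply: le_trans xy; have [xy|yx] := leP x y.
  have /andP[h1 h2] := dPhi y x y x0 xy (lexx _).
  have xy0 : 0 <= y - x by rewrite subr_ge0.
  have h0 : 0 <= (y - x) * g y by rewrite mulr_ge0// ltW// gpos// (lt_trans x2).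
  rewrite ger0_norm ?(le_trans h0)// distrC ger0_norm// (le_trans h2)//.
  by rewrite ler_wpM2l// gni// ltW.
have y0 := lt_trans x2 y2.
have /andP[h1 h2] := dPhi x y x y0 (ltW yx) (lexx _).
have yx0 : 0 <= x - y by rewrite subr_ge0 ltW.
have h0 : 0 <= (x - y) * g x by rewrite mulr_ge0// ltW// gpos.
rewrite distrC ger0_norm ?(le_trans h0)// ger0_norm// (le_trans h2)//.
by rewrite ler_wpM2l// gni// ltW.
Unshelve. all: by end_near.
Qed.

(** * Inverses of functions with a nonincreasing density *)

(** By the intermediate value theorem every y >= Phi 1 is attained on []0, 1]], as Phi is unbounded
    at 0; strict monotonicity makes the partial inverse exact there. The point 1 is an arbitrary
    anchor. *)
Lemma inv_posK (R : realType) (g Phi : R -> R) (y : R) :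
  posmono g -> (forall t0, density_on t0 g Phi) -> Phi u @[u --> 0^'+] --> +oo ->
  Phi 1 <= y -> 0 < inv_pos Phi y /\ Phi (inv_pos Phi y) = y.
Proof.
move=> pg dPhi Phioo y1.
have [u /andP[u0 u1] yu] : exists2 u, 0 < u <= 1 & y <= Phi u.
  have /near_at0P[d d0 Hd] : \forall u \near 0^'+, y <= Phi u.
    by move/cvgryPge: Phioo; apply.
  exists (Num.min d 1); first by rewrite lt_min d0 ltr01/= ge_min lexx orbT.
  by apply: Hd; rewrite lt_min d0 ltr01/= ge_min lexx.
have hv : Num.min (Phi u) (Phi 1) <= y <= Num.max (Phi u) (Phi 1).
  by rewrite ge_min le_max yu y1 orbT.
have [c] := IVT u1 (density_continuous pg dPhi u0) hv.
rewrite in_itv/= => /andP[uc _] cy; have c0 := lt_le_trans u0 uc.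
have cE : [set Phi x | x in `]0, +oo[] y.
  by exists c => //=; rewrite in_itv/= c0.
have inj : {in `]0, +oo[%classic &, injective Phi}.
  move=> x z; rewrite !inE/= !in_itv/= !andbT => x0 z0 xz.
  have [xz'|zx|//] := ltgtP x z.
    by have := density_decreasing pg dPhi x0 xz'; rewrite xz ltxx.
  by have := density_decreasing pg dPhi z0 zx; rewrite xz ltxx.
split; last by rewrite /inv_pos pinvK// inE.
have : [set inv_pos Phi x | x in [set Phi x | x in `]0, +oo[]] (inv_pos Phi y).
  by exists y.
by rewrite /inv_pos (injpinv_image _ inj)/= in_itv/= andbT.
Qed.

Lemma inv_pos_le (R : realType) (g Phi : R -> R) (x y : R) :
  posmono g -> (forall t0, density_on t0 g Phi) -> Phi u @[u --> 0^'+] --> +oo ->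
  Phi 1 <= y -> 0 < x -> Phi x <= y -> inv_pos Phi y <= x.
Proof.
move=> pg dPhi Phioo y1 x0 xy; rewrite leNgt; apply/negP => h.
have [_ e] := inv_posK pg dPhi Phioo y1.
by have := density_decreasing pg dPhi x0 h; rewrite e ltNge xy.
Qed.

Lemma inv_pos_ge (R : realType) (g Phi : R -> R) (x y : R) :
  posmono g -> (forall t0, density_on t0 g Phi) -> Phi u @[u --> 0^'+] --> +oo ->
  Phi 1 <= y -> 0 < x -> y <= Phi x -> x <= inv_pos Phi y.
Proof.
move=> pg dPhi Phioo y1 x0 xy; rewrite leNgt; apply/negP => h.
have [i0 e] := inv_posK pg dPhi Phioo y1.
by have := density_decreasing pg dPhi i0 h; rewrite e ltNge xy.
Qed.

Lemma inv_pos_nonincreasing (R : realType) (g Phi : R -> R) (y z : R) :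
  posmono g -> (forall t0, density_on t0 g Phi) -> Phi u @[u --> 0^'+] --> +oo ->
  Phi 1 <= y -> y <= z -> inv_pos Phi z <= inv_pos Phi y.
Proof.
move=> pg dPhi Phioo y1 yz; have [i0 e] := inv_posK pg dPhi Phioo y1.
by apply: (inv_pos_le pg dPhi Phioo) => //; [exact: le_trans yz|rewrite e].
Qed.

Lemma inv_pos_near0 (R : realType) (g Phi : R -> R) (e : R) :
  posmono g -> (forall t0, density_on t0 g Phi) -> Phi u @[u --> 0^'+] --> +oo ->
  0 < e -> \forall y \near +oo, inv_pos Phi y <= e.
Proof.
move=> pg dPhi Phioo e0; near=> y.
by apply: (inv_pos_le pg dPhi Phioo) => //; near: y;
  apply: nbhs_pinfty_ge; exact: num_real.
Unshelve. all: by end_near.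
Qed.

(** With u the preimage of y, the hypothesis says Phi (mu * u) <= l * y, and the inverse is
    decreasing: argument and value scales change places. *)
Lemma inv_pos_scale_le (R : realType) (g Phi : R -> R) (l mu : R) :
  posmono g -> (forall t0, density_on t0 g Phi) -> Phi u @[u --> 0^'+] --> +oo ->
  0 < l -> 0 < mu -> (\forall u \near 0^'+, Phi (mu * u) <= l * Phi u) ->
  \forall y \near +oo, inv_pos Phi (l * y) <= mu * inv_pos Phi y.
Proof.
move=> pg dPhi Phioo l0 mu0 /near_at0P[d d0 Hd].
near=> y.
have y1 : Phi 1 <= y by near: y; apply: nbhs_pinfty_ge; exact: num_real.
have ly1 : Phi 1 <= l * y.
  by rewrite -ler_pdivrMl//; near: y; apply: nbhs_pinfty_ge; exact: num_real.
have [i0 e] := inv_posK pg dPhi Phioo y1.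
apply: (inv_pos_le pg dPhi Phioo) => //; first exact: mulr_gt0.
rewrite -[in leRHS]e; apply: Hd; rewrite i0/=.
by near: y; exact: inv_pos_near0 pg dPhi Phioo d0.
Unshelve. all: by end_near.
Qed.

Lemma inv_pos_scale_ge (R : realType) (g Phi : R -> R) (l mu : R) :
  posmono g -> (forall t0, density_on t0 g Phi) -> Phi u @[u --> 0^'+] --> +oo ->
  0 < l -> 0 < mu -> (\forall u \near 0^'+, l * Phi u <= Phi (mu * u)) ->
  \forall y \near +oo, mu * inv_pos Phi y <= inv_pos Phi (l * y).
Proof.
move=> pg dPhi Phioo l0 mu0 /near_at0P[d d0 Hd].
near=> y.
have y1 : Phi 1 <= y by near: y; apply: nbhs_pinfty_ge; exact: num_real.
have ly1 : Phi 1 <= l * y.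
  by rewrite -ler_pdivrMl//; near: y; apply: nbhs_pinfty_ge; exact: num_real.
have [i0 e] := inv_posK pg dPhi Phioo y1.
apply: (inv_pos_ge pg dPhi Phioo) => //; first exact: mulr_gt0.
rewrite -[in leLHS]e; apply: Hd; rewrite i0/=.
by near: y; exact: inv_pos_near0 pg dPhi Phioo d0.
Unshelve. all: by end_near.
Qed.

(** * Regular variation of inverses, and the case of index 0 *)

Lemma nondecreasing_on_measurable (R : realType) (D : set R) (f : R -> R) :
  is_interval D -> {in D &, {homo f : x y / x <= y}} -> measurable_fun D f.
Proof.
move=> iD f_nd; rewrite -(opprK f); apply/measurable_funN.
by apply: nonincreasing_on_measurable => // x y xD yD yx; rewrite lerN2 f_nd.
Qed.

Lemma posmeas_at0_density (R : realType) (g Phi : R -> R) :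
  posmono g -> (forall t0, density_on t0 g Phi) -> Phi u @[u --> 0^'+] --> +oo ->
  posmeas_at0 Phi /\ posmeas_at0 (fun u => (Phi u)^-1).
Proof.
move=> pg dPhi Phioo.
have /near_at0P[d d0 Hd] := near0_gt0 Phioo.
split; exists d => //; split.
- exact: Hd.
- apply: nonincreasing_on_measurable; first exact: interval_is_interval.
  move=> x y _; rewrite !inE/= !in_itv/= => /andP[y0 _] yx.
  exact: (density_nonincreasing pg dPhi).
- by move=> x xd; rewrite invr_gt0 Hd.
- apply: nondecreasing_on_measurable; first exact: interval_is_interval.
  move=> x y; rewrite !inE/= !in_itv/= => xd yd xy.
  rewrite lef_pV2 ?posrE ?Hd//; apply: (density_nonincreasing pg dPhi) => //.
  by case/andP: xd.
Qed.

Lemma posmeas_at_pinfty_inv_pos (R : realType) (g Phi : R -> R) :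
  posmono g -> (forall t0, density_on t0 g Phi) -> Phi u @[u --> 0^'+] --> +oo ->
  posmeas_at_pinfty (inv_pos Phi) /\ posmeas_at_pinfty (fun y => (inv_pos Phi y)^-1).
Proof.
move=> pg dPhi Phioo; pose M := Num.max 1 (Phi 1).
have M0 : 0 < M by rewrite lt_max ltr01.
have M1 y : M <= y -> Phi 1 <= y by rewrite ge_max => /andP[].
have pos y : M <= y -> 0 < inv_pos Phi y.
  by move=> /M1 h; case: (inv_posK pg dPhi Phioo h).
split; exists M => //; split=> //.
- apply: nonincreasing_on_measurable; first exact: interval_is_interval.
  move=> x y; rewrite !inE/= !in_itv/= !andbT => Mx My yx.
  by apply: (inv_pos_nonincreasing pg dPhi) => //; exact: M1.
- by move=> y My; rewrite invr_gt0 pos.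
- apply: nondecreasing_on_measurable; first exact: interval_is_interval.
  move=> x y; rewrite !inE/= !in_itv/= !andbT => Mx My xy.
  rewrite lef_pV2 ?posrE ?pos//.
  by apply: (inv_pos_nonincreasing pg dPhi) => //; exact: M1.
Qed.

Lemma near_inv_pos_gt0 (R : realType) (g Phi : R -> R) :
  posmono g -> (forall t0, density_on t0 g Phi) -> Phi u @[u --> 0^'+] --> +oo ->
  \forall y \near +oo, 0 < inv_pos Phi y.
Proof.
move=> pg dPhi Phioo; near=> y; apply: (proj1 (inv_posK pg dPhi Phioo _)).
by near: y; apply: nbhs_pinfty_ge; exact: num_real.
Unshelve. all: by end_near.
Qed.

Lemma near_scale_pinfty (R : realType) (l : R) (P : R -> Prop) : 0 < l ->
  (\forall y \near +oo, P y) -> \forall y \near +oo, P (l * y).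
Proof.
move=> l0 /near_pinftyP[M M0 HM]; apply/near_pinftyP; exists (M / l).
  exact: divr_gt0.
by move=> y My; apply: HM; rewrite mulrC -ler_pdivrMr.
Qed.

Lemma Karamata_ratio_lt (R : realType) (f : R -> R) (p k c : R) :
  Karamata_ratio f p -> (\forall u \near 0^'+, 0 < f u) -> 0 < k -> k `^ p < c ->
  \forall u \near 0^'+, f (k * u) <= c * f u.
Proof.
move=> fp f0 k0 kc; near=> u.
rewrite -ler_pdivrMr; last by near: u; exact: f0.
by rewrite ltW//; near: u; exact: (cvgr_lt _ (fp k k0)).
Unshelve. all: by end_near.
Qed.

Lemma Karamata_ratio_gt (R : realType) (f : R -> R) (p k c : R) :
  Karamata_ratio f p -> (\forall u \near 0^'+, 0 < f u) -> 0 < k -> c < k `^ p ->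
  \forall u \near 0^'+, c * f u <= f (k * u).
Proof.
move=> fp f0 k0 kc; near=> u.
rewrite -ler_pdivlMr; last by near: u; exact: f0.
by rewrite ltW//; near: u; exact: (cvgr_gt _ (fp k k0)).
Unshelve. all: by end_near.
Qed.

(** The hypotheses are scale inequalities rather than a ratio limit of Phi, so that q = 0 is
    included, where Phi varies rapidly and has no finite index. *)
Lemma RV_inv_pos (R : realType) (g Phi : R -> R) (q : R) :
  posmono g -> (forall t0, density_on t0 g Phi) -> Phi u @[u --> 0^'+] --> +oo ->
  (forall l c, 0 < l -> 0 < c -> l `^ q < c ->
     \forall u \near 0^'+, Phi (c * u) <= l * Phi u) ->
  (forall l c, 0 < l -> 0 < c -> c < l `^ q ->
     \forall u \near 0^'+, l * Phi u <= Phi (c * u)) ->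
  RV q (inv_pos Phi).
Proof.
move=> pg dPhi Phioo Hu Hl; split.
  by case: (posmeas_at_pinfty_inv_pos pg dPhi Phioo).
move=> l l0; have inv0 := near_inv_pos_gt0 pg dPhi Phioo.
apply: (@cvg_between _ _ (pinfty_nbhs R)) => c lc.
  have c0 : 0 < c by apply: lt_trans lc; exact: powR_gt0.
  near=> y; rewrite ler_pdivrMr; last by near: y; exact: inv0.
  near: y; apply: (inv_pos_scale_le pg dPhi Phioo l0 c0); exact: Hu.
have [c0|c0] := leP c 0.
  near=> y; rewrite (le_trans c0)// divr_ge0// ltW//; near: y; last exact: inv0.
  exact: (near_scale_pinfty l0 inv0).
near=> y; rewrite ler_pdivlMr; last by near: y; exact: inv0.
near: y; apply: (inv_pos_scale_ge pg dPhi Phioo l0 c0); exact: Hl.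
Unshelve. all: by end_near.
Qed.

Lemma RV_inv_pos_neg (R : realType) (g Phi : R -> R) (p : R) :
  posmono g -> (forall t0, density_on t0 g Phi) -> Phi u @[u --> 0^'+] --> +oo ->
  p < 0 -> Karamata_ratio Phi p -> RV p^-1 (inv_pos Phi).
Proof.
move=> pg dPhi Phioo p0 Phip; have Phi0 := near0_gt0 Phioo.
have pn0 : p != 0 by rewrite lt_eqF.
apply: (RV_inv_pos pg dPhi Phioo) => l c l0 c0 lc.
  apply: (Karamata_ratio_lt Phip Phi0 c0).
  by rewrite -[ltRHS](powRK l0 pn0); apply: powR_lt_neg => //; exact: powR_gt0.
apply: (Karamata_ratio_gt Phip Phi0 c0).
by rewrite -[ltLHS](powRK l0 pn0); apply: powR_lt_neg.
Qed.

Lemma cvg_id_ratio (R : realType) (f : R -> R) (G : set_system R) (FG : Filter G) :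
  (\forall x \near G, 0 < f x) -> f (1 * x) / f x @[x --> G] --> (1 : R).
Proof.
move=> f0; apply: cvg_between => c c1; near=> x; rewrite mul1r divff ?ltW//;
  by rewrite gt_eqF//; near: x; exact: f0.
Unshelve. all: by end_near.
Qed.

(** A slowly varying Phi barely changes when u is multiplied by any fixed constant, so multiplying
    its value by l != 1 forces an arbitrarily large change of the argument. *)
Lemma RV_ninfty_inv_pos (R : realType) (g Phi : R -> R) :
  posmono g -> (forall t0, density_on t0 g Phi) -> Phi u @[u --> 0^'+] --> +oo ->
  Karamata_ratio Phi 0 -> RV_ninfty (inv_pos Phi).
Proof.
move=> pg dPhi Phioo Phip; have Phi0 := near0_gt0 Phioo.
have inv0 := near_inv_pos_gt0 pg dPhi Phioo.
split.
- by case: (posmeas_at_pinfty_inv_pos pg dPhi Phioo).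
- move=> l /andP[l0 l1]; apply: (@cvg_between _ _ (pinfty_nbhs R)) => c c0; last first.
    near=> y; rewrite (le_trans (ltW c0))// divr_ge0// invr_ge0 ltW//;
      near: y; last exact: inv0.
    exact: (near_scale_pinfty l0 inv0).
  have ci0 : 0 < c^-1 by rewrite invr_gt0.
  have H : \forall y \near +oo, c^-1 * inv_pos Phi y <= inv_pos Phi (l * y).
    apply: (inv_pos_scale_ge pg dPhi Phioo l0 ci0).
    by apply: (Karamata_ratio_gt Phip Phi0 ci0); rewrite powRr0.
  near=> y.
  have il0 : 0 < inv_pos Phi (l * y) by near: y; exact: (near_scale_pinfty l0 inv0).
  rewrite invrK mulrC ler_pdivrMr// -ler_pdivrMl//.
  by near: y; exact: H.
- by apply: (@cvg_id_ratio _ _ (pinfty_nbhs R)); near=> y; rewrite invr_gt0; near: y; exact: inv0.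
- move=> l l1; have l0 := lt_trans ltr01 l1; apply/cvgryPge => A.
  (* The bound A may be negative; the maximum with 1 makes c^-1 a legitimate scale. *)
  pose c := Num.max 1 A; have c0 : 0 < c by rewrite lt_max ltr01.
  have ci0 : 0 < c^-1 by rewrite invr_gt0.
  have H : \forall y \near +oo, inv_pos Phi (l * y) <= c^-1 * inv_pos Phi y.
    apply: (inv_pos_scale_le pg dPhi Phioo l0 ci0).
    by apply: (Karamata_ratio_lt Phip Phi0 ci0); rewrite powRr0.
  near=> y; apply: (@le_trans _ _ c); first by rewrite le_max lexx orbT.
  have il0 : 0 < inv_pos Phi (l * y) by near: y; exact: (near_scale_pinfty l0 inv0).
  rewrite invrK mulrC ler_pdivlMr// -ler_pdivlMl//.
  by near: y; exact: H.
Unshelve. all: by end_near.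
Qed.

(** As mu^0 = 1, the only constraint is on which side of 1 the scale l lies, and mu is free: it is
    taken so that l / mu equals C + 1 for a lower bound and C / 2 for an upper one. *)
Lemma RVat0_ninfty_integral (R : realType) (a : R) (f Phi : R -> R) :
  gauge f -> 0 < a -> Karamata_ratio f 0 ->
  (forall t0, density_on t0 (fun t => (minus_inv a f t)^-1) Phi) ->
  Phi u @[u --> 0^'+] --> +oo ->
  RVat0_ninfty Phi /\ RV 0 (inv_pos Phi).
Proof.
move=> gf a0 f0 dPhi Phioo; have Phi0 := near0_gt0 Phioo.
have pg := posmono_minus_inv gf a0.
have Hlt l C : 0 < l -> l < 1 -> 0 < C -> \forall u \near 0^'+, C * Phi u <= Phi (l * u).
  move=> l0 l1 C0; have m0 : 0 < l / (C + 1) by rewrite divr_gt0// ltr_wpDr.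
  apply: (inv_minus_inv_scale_ge gf a0 f0 dPhi Phioo l0 m0); first by rewrite powRr0.
  by rewrite invf_div mulrCA divff ?gt_eqF// mulr1 ltrDl.
have Hgt l C : 1 < l -> 0 < C -> \forall u \near 0^'+, Phi (l * u) <= C * Phi u.
  move=> l1 C0; have l0 := lt_trans ltr01 l1.
  have m0 : 0 < l / (C / 2) by rewrite !divr_gt0.
  apply: (inv_minus_inv_scale_le gf a0 f0 dPhi Phioo l0 m0); first by rewrite powRr0.
  by rewrite invf_div mulrCA divff ?gt_eqF// mulr1; lra.
have near_scale l P : 0 < l -> (\forall y \near (0 : R)^'+, P y) ->
    \forall y \near 0^'+, P (l * y).
  move=> l0 /near_at0P[d d0 Hd]; apply/near_at0P; exists (d / l).
    exact: divr_gt0.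
  move=> y /andP[y0 yd]; apply: Hd.
  by rewrite mulr_gt0//= mulrC -ler_pdivlMr.
split.
  split.
  - by case: (posmeas_at0_density pg dPhi Phioo).
  - move=> l /andP[l0 l1]; apply: cvg_between => c c0; last first.
      near=> y; rewrite (le_trans (ltW c0))// divr_ge0// invr_ge0 ltW//; near: y.
        exact: (near_scale _ _ l0 Phi0).
      exact: Phi0.
    have ci0 : 0 < c^-1 by rewrite invr_gt0.
    near=> y; have il0 : 0 < Phi (l * y) by near: y; exact: (near_scale _ _ l0 Phi0).
    rewrite invrK mulrC ler_pdivrMr// -ler_pdivrMl//.
    by near: y; exact: Hlt.
  - by apply: cvg_id_ratio; near=> y; rewrite invr_gt0; near: y; exact: Phi0.
  - move=> l l1; have l0 := lt_trans ltr01 l1; apply/cvgryPge => A.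
    pose c := Num.max 1 A; have c0 : 0 < c by rewrite lt_max ltr01.
    have ci0 : 0 < c^-1 by rewrite invr_gt0.
    near=> y; apply: (@le_trans _ _ c); first by rewrite le_max lexx orbT.
    have il0 : 0 < Phi (l * y) by near: y; exact: (near_scale _ _ l0 Phi0).
    rewrite invrK mulrC ler_pdivlMr// -ler_pdivlMl//.
    by near: y; exact: Hgt.
apply: (RV_inv_pos pg dPhi Phioo) => l c l0 c0; rewrite powRr0 => lc.
  exact: Hgt.
exact: Hlt.
Unshelve. all: by end_near.
Qed.

(** * Power bounds *)

(** Induction over dyadic blocks: beyond 2 * M the point y / 2 is still at least M, and the factor q
    acts on both sides. *)
Lemma doubling_le (R : realType) (f h : R -> R) (q M : R) :
  0 <= q -> 0 < M ->
  (forall y, M <= y -> y <= 2 * M -> f y <= h y) ->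
  (forall y, M <= y -> f (2 * y) <= q * f y) ->
  (forall y, M <= y -> q * h y <= h (2 * y)) ->
  forall y, M <= y -> f y <= h y.
Proof.
move=> q0 M0 base fq hq.
have step n : forall y, M <= y -> y <= 2 ^+ n.+1 * M -> f y <= h y.
  elim: n => [|n IH] y My yM; first by apply: base => //; rewrite expr1 in yM.
  have [y2|y2] := leP y (2 * M); first exact: base.
  have y2M : M <= y / 2 by lra.
  have e : y = 2 * (y / 2) by field.
  rewrite e (le_trans (fq _ y2M))// (le_trans _ (hq _ y2M))// ler_wpM2l//.
  by apply: IH => //; rewrite ler_pdivrMr// mulrC mulrA -exprS.
move=> y My.
pose n := Num.bound `|y / M|.
apply: (step n) => //; rewrite -ler_pdivrMr//.
rewrite (le_trans (ler_norm _))// (@le_trans _ _ n%:R)//; first by rewrite ltW// archi_boundP.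
by rewrite -natrX ler_nat ltnW// ltnW// ltn_expl.
Qed.

Lemma near_powR_neg_le (R : realType) (p c : R) : p < 0 -> 0 < c ->
  \forall y \near +oo, y `^ p <= c.
Proof.
move=> p0 c0; apply/near_pinftyP; exists (c `^ p^-1); first exact: powR_gt0.
move=> y cy; rewrite -[leRHS](@powRK _ p) ?lt_eqF//.
move: cy; rewrite le_eqVlt => /predU1P[<-//|cy].
by rewrite ltW// powR_lt_neg// powR_gt0.
Qed.

(* Potter-type bounds: only the factor at scale 2 is controlled, monotonicity
   covers the points between consecutive powers of 2. *)
Lemma near_le_powR (R : realType) (f : R -> R) (p p' e : R) :
  p' < p -> p' < 0 -> 0 < e ->
  (\forall y \near +oo, 0 < f y) ->
  (exists M, forall y z, M <= y -> y <= z -> f z <= f y) ->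
  (\forall y \near +oo, f (2 * y) <= 2 `^ p' * f y) ->
  \forall y \near +oo, f y <= e * y `^ p.
Proof.
move=> pp p'0 e0 /near_pinftyP[M1 M10 f0] [M2 fni] /near_pinftyP[M3 M30 f2].
pose M := Num.max M1 (Num.max M2 M3).
have MM1 : M1 <= M by rewrite le_max lexx.
have MM2 : M2 <= M by rewrite !le_max lexx !orbT.
have MM3 : M3 <= M by rewrite !le_max lexx !orbT.
have M0 : 0 < M by exact: lt_le_trans MM1.
have M20 : 0 < 2 * M by rewrite mulr_gt0.
have fM := f0 _ MM1.
have p20 : 0 < (2 * M) `^ p' by exact: powR_gt0.
(* On [M, 2 * M] both functions decrease, so f is compared at the left end and the power at the
   right end. *)
pose C := f M / (2 * M) `^ p'; have C0 : 0 < C by rewrite divr_gt0.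
have bound : forall y, M <= y -> f y <= C * y `^ p'.
  apply: (doubling_le (powR_ge0 2 p') M0) => y My.
  - move=> y2; have y0 := lt_le_trans M0 My.
    rewrite (le_trans (fni _ _ MM2 My))// /C -mulrA ler_peMr ?(ltW fM)//.
    rewrite ler_pdivlMl// mulr1; move: y2; rewrite le_eqVlt => /predU1P[->//|y2].
    by rewrite ltW// powR_lt_neg.
  - by apply: f2; exact: le_trans My.
  - have y0 := lt_le_trans M0 My.
    by rewrite powRM ?(ltW y0)// mulrCA.
near=> y.
have My : M <= y by near: y; apply: nbhs_pinfty_ge; exact: num_real.
have y0 := lt_le_trans M0 My.
rewrite (le_trans (bound _ My))//.
(* The surplus exponent p' - p < 0 gives a factor tending to 0, which beats both C and e. *)
have -> : y `^ p' = y `^ (p' - p) * y `^ p.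
  by rewrite -powRD ?subrK//; apply/implyP => _; rewrite gt_eqF.
rewrite mulrA ler_pM2r ?powR_gt0// -ler_pdivlMl// mulrC.
by near: y; apply: near_powR_neg_le; rewrite ?subr_lt0// divr_gt0.
Unshelve. all: by end_near.
Qed.

Lemma near_ge_powR (R : realType) (f : R -> R) (p p' e : R) :
  p < p' -> p' < 0 -> 0 < e ->
  (\forall y \near +oo, 0 < f y) ->
  (exists M, forall y z, M <= y -> y <= z -> f z <= f y) ->
  (\forall y \near +oo, 2 `^ p' * f y <= f (2 * y)) ->
  \forall y \near +oo, y `^ p <= e * f y.
Proof.
move=> pp p'0 e0 /near_pinftyP[M1 M10 f0] [M2 fni] /near_pinftyP[M3 M30 f2].
pose M := Num.max M1 (Num.max M2 M3).
have MM1 : M1 <= M by rewrite le_max lexx.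
have MM2 : M2 <= M by rewrite !le_max lexx !orbT.
have MM3 : M3 <= M by rewrite !le_max lexx !orbT.
have M0 : 0 < M by exact: lt_le_trans MM1.
have M20 : 0 < 2 * M by rewrite mulr_gt0.
have MM : M <= 2 * M by lra.
have fM := f0 _ (le_trans MM1 MM).
have p20 : 0 < M `^ p' by exact: powR_gt0.
(* For a lower bound the two ends of the base block exchange roles. *)
pose C := f (2 * M) / M `^ p'; have C0 : 0 < C by rewrite divr_gt0.
have bound : forall y, M <= y -> C * y `^ p' <= f y.
  apply: (doubling_le (powR_ge0 2 p') M0) => y My.
  - move=> y2; have y0 := lt_le_trans M0 My.
    rewrite (le_trans _ (fni _ _ (le_trans MM2 My) y2))// /C -mulrA ler_piMr ?(ltW fM)//.
    rewrite ler_pdivrMl// mulr1; move: My; rewrite le_eqVlt => /predU1P[->//|My].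
    by rewrite ltW// powR_lt_neg.
  - have y0 := lt_le_trans M0 My.
    by rewrite powRM ?(ltW y0)// mulrCA.
  - by apply: f2; exact: le_trans My.
near=> y.
have My : M <= y by near: y; apply: nbhs_pinfty_ge; exact: num_real.
have y0 := lt_le_trans M0 My.
have h : e * (C * y `^ p') <= e * f y by rewrite ler_pM2l// bound.
apply: le_trans h.
have -> : y `^ p = y `^ (p - p') * y `^ p'.
  by rewrite -powRD ?subrK//; apply/implyP => _; rewrite gt_eqF.
rewrite mulrA ler_pM2r ?powR_gt0//.
by near: y; apply: near_powR_neg_le; rewrite ?subr_lt0// mulr_gt0.
Unshelve. all: by end_near.
Qed.

Lemma near_nat_pinfty (R : realType) (P : R -> Prop) :
  (\forall y \near +oo, P y) -> \forall k \near \oo, P k%:R.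
Proof. by move=> h; exact: (cvgr_idn h). Qed.

Lemma inv_pos_littleo_powR (R : realType) (g Phi : R -> R) (r r' : R) :
  posmono g -> (forall t0, density_on t0 g Phi) -> Phi u @[u --> 0^'+] --> +oo ->
  r < r' -> 0 < r' ->
  (\forall y \near +oo, inv_pos Phi (2 * y) <= 2 `^ (- r') * inv_pos Phi y) ->
  (fun k : nat => inv_pos Phi k%:R) =o_\oo (fun k : nat => (k%:R : R) `^ (- r)).
Proof.
move=> pg dPhi Phioo rr r'0 H; apply/eqoP => e e0.
have inv0 := near_inv_pos_gt0 pg dPhi Phioo.
have B : \forall y \near +oo, inv_pos Phi y <= e * y `^ (- r).
  apply: (near_le_powR _ _ e0 inv0 _ H); rewrite ?ltrN2 ?oppr_lt0//.
  by exists (Phi 1) => y z; exact: (inv_pos_nonincreasing pg dPhi Phioo).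
near=> k; rewrite (ger0_norm (powR_ge0 _ _)) gtr0_norm.
  by near: k; exact: (near_nat_pinfty B).
by near: k; exact: (near_nat_pinfty inv0).
Unshelve. all: by end_near.
Qed.

Lemma powR_littleo_inv_pos (R : realType) (g Phi : R -> R) (r r' : R) :
  posmono g -> (forall t0, density_on t0 g Phi) -> Phi u @[u --> 0^'+] --> +oo ->
  r' < r -> 0 < r' ->
  (\forall y \near +oo, 2 `^ (- r') * inv_pos Phi y <= inv_pos Phi (2 * y)) ->
  (fun k : nat => (k%:R : R) `^ (- r)) =o_\oo (fun k : nat => inv_pos Phi k%:R).
Proof.
move=> pg dPhi Phioo rr r'0 H; apply/eqoP => e e0.
have inv0 := near_inv_pos_gt0 pg dPhi Phioo.
have B : \forall y \near +oo, y `^ (- r) <= e * inv_pos Phi y.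
  apply: (near_ge_powR _ _ e0 inv0 _ H); rewrite ?ltrN2 ?oppr_lt0//.
  by exists (Phi 1) => y z; exact: (inv_pos_nonincreasing pg dPhi Phioo).
near=> k; rewrite (ger0_norm (powR_ge0 _ _)) gtr0_norm.
  by near: k; exact: (near_nat_pinfty B).
by near: k; exact: (near_nat_pinfty inv0).
Unshelve. all: by end_near.
Qed.

(** * The function phi built from psi *)

Lemma near_sqrt (R : realType) (K : R) (P : R -> Prop) : 0 < K ->
  (\forall t \near 0^'+, P t) -> \forall u \near 0^'+, P (Num.sqrt (K * u)).
Proof.
move=> K0 /near_at0P[d d0 Hd]; apply/near_at0P; exists (d ^+ 2 / K).
  by rewrite divr_gt0// exprn_gt0.
move=> u /andP[u0 ud]; apply: Hd; rewrite sqrtr_gt0 mulr_gt0//=.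
rewrite -[leRHS]ger0_norm ?(ltW d0)// -sqrtr_sqr ler_wsqrtr//.
by rewrite mulrC -ler_pdivlMr.
Qed.

Lemma gauge_sqr_sqrt (R : realType) (K : R) (psi : R -> R) :
  0 < K -> (forall t u : R, 0 <= t -> t <= u -> psi t <= psi u) ->
  (\forall t \near 0^'+, 0 < psi t) -> psi t @[t --> 0^'+] --> (0 : R) ->
  gauge (fun u => psi (Num.sqrt (K * u)) ^+ 2).
Proof.
move=> K0 psi_nd /near_at0P[d d0 Hd] psi0.
(* Positivity is known only near 0 and spreads to the right by monotonicity. *)
have psipos x : 0 < x -> 0 < psi x.
  move=> x0; apply: (@lt_le_trans _ _ (psi (Num.min x d))).
    by apply: Hd; rewrite lt_min x0 d0 ge_min lexx orbT.
  by apply psi_nd; [rewrite le_min !ltW|rewrite ge_min lexx].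
split.
- by move=> x x0; rewrite exprn_gt0// psipos// sqrtr_gt0 mulr_gt0.
- move=> x y x0 xy; have y0 := lt_le_trans x0 xy.
  have pos z : 0 < z -> 0 <= psi (Num.sqrt (K * z)).
    by move=> z0; rewrite ltW// psipos// sqrtr_gt0 mulr_gt0.
  rewrite ler_sqr ?nnegrE ?pos//.
  by apply psi_nd; rewrite ?sqrtr_ge0// ler_wsqrtr// ler_pM2l.
- have psi1 : psi (Num.sqrt (K * u)) @[u --> 0^'+] --> (0 : R).
    by move=> A /psi0 hA; exact: (near_sqrt K0 hA).
  by rewrite -[X in _ --> X](mulr0 0); under eq_fun do rewrite expr2; exact: cvgM.
Qed.

(** The inner square root halves the index and the outer square doubles it, so phi keeps the index
    of psi. *)
Lemma Karamata_ratio_sqr_sqrt (R : realType) (K rho : R) (psi : R -> R) : 0 < K ->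
  (forall l : R, 0 < l -> psi (l * x) / psi x @[x --> 0^'+] --> l `^ rho) ->
  Karamata_ratio (fun u => psi (Num.sqrt (K * u)) ^+ 2) rho.
Proof.
move=> K0 psirho k k0.
have sk0 : 0 < Num.sqrt k by rewrite sqrtr_gt0.
have h1 : psi (Num.sqrt k * Num.sqrt (K * u)) / psi (Num.sqrt (K * u))
    @[u --> 0^'+] --> Num.sqrt k `^ rho.
  by move=> A /(psirho _ sk0) hA; exact: (near_sqrt K0 hA).
have -> : k `^ rho = Num.sqrt k `^ rho * Num.sqrt k `^ rho.
  by rewrite -powRM ?sqrtr_ge0// -expr2 sqr_sqrtr// ltW.
have -> : (fun x => psi (Num.sqrt (K * (k * x))) ^+ 2 / psi (Num.sqrt (K * x)) ^+ 2) =
  (fun x => psi (Num.sqrt k * Num.sqrt (K * x)) / psi (Num.sqrt (K * x)) *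
            (psi (Num.sqrt k * Num.sqrt (K * x)) / psi (Num.sqrt (K * x)))).
  by apply/funext => x; rewrite mulrCA sqrtrM ?ltW// -expr2 expr_div_n.
exact: cvgM.
Qed.

Lemma sqr_sqrt_ge_linear (R : realType) (K : R) (psi : R -> R) : 0 < K ->
  (\forall t \near 0^'+, t / 2 <= psi t) ->
  \forall u \near 0^'+, K / 4 * u <= psi (Num.sqrt (K * u)) ^+ 2.
Proof.
move=> K0 /(near_sqrt K0) H; near=> u.
have u0 : 0 < u by near: u; exact: nbhs_right_gt.
have h : Num.sqrt (K * u) / 2 <= psi (Num.sqrt (K * u)) by near: u; exact: H.
have -> : K / 4 * u = (Num.sqrt (K * u) / 2) ^+ 2.
  by rewrite expr_div_n sqr_sqrtr ?mulr_ge0 ?ltW//; field.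
have s0 : 0 <= Num.sqrt (K * u) / 2 by rewrite divr_ge0// sqrtr_ge0.
by rewrite ler_sqr ?nnegrE//; exact: le_trans h.
Unshelve. all: by end_near.
Qed.

(** * The quasi-cyclic algorithm *)

(** The one place where the inner product is expanded. The last term is the gain of averaged
    operators over nonexpansive ones. *)
Lemma sqr_norm_convex (R : realType) (E : normedModType R) :
  euclidean_space E -> forall (a : R) (x y : E),
  `|(1 - a) *: x + a *: y| ^+ 2 =
  (1 - a) * `|x| ^+ 2 + a * `|y| ^+ 2 - a * (1 - a) * `|x - y| ^+ 2.
Proof.
move=> [[dot dotE] _] a x y.
have symm u v : dot u v = dot v u by rewrite hermC mul1r.
have Dl u v z : dot (u + v) z = dot u z + dot v z by rewrite linearDl.
have Dr u v z : dot z (u + v) = dot z u + dot z v by rewrite linearDr.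
have Zl c u z : dot (c *: u) z = c * dot u z by rewrite linearZl_LR.
have Zr c u z : dot z (c *: u) = c * dot z u by rewrite linearZr_LR.
have Nl u z : dot (- u) z = - dot u z by rewrite linearNl.
have Nr u z : dot z (- u) = - dot z u by rewrite linearNr.
by rewrite !dotE !(Dl, Dr, Zl, Zr, Nl, Nr) (symm y x); ring.
Qed.

Lemma averaged_nonexpansive (R : realType) (E : normedModType R) (alpha : R)
    (T : E -> E) :
  0 < alpha < 1 -> averaged alpha T -> nonexpansive T.
Proof.
move=> /andP[a0 a1] [S nS TE] x y; rewrite !TE.
have -> : (1 - alpha) *: x + alpha *: S x - ((1 - alpha) *: y + alpha *: S y) =
    (1 - alpha) *: (x - y) + alpha *: (S x - S y).
  by rewrite !scalerBr opprD addrACA.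
rewrite (le_trans (ler_normD _ _))// !normrZ !gtr0_norm ?subr_gt0//.
have := nS x y; rewrite -(ler_pM2l a0); lra.
Qed.

(** A fixed point z of T is fixed by S, so T x - z is a convex combination of x - z and S x - z,
    whose difference x - S x is (x - T x) / alpha. The gain in the convexity identity is then
    exactly the second term. *)
Lemma averaged_fixed_sqr (R : realType) (E : normedModType R) (alpha : R)
    (T : E -> E) (x z : E) :
  euclidean_space E -> 0 < alpha < 1 -> averaged alpha T -> T z = z ->
  `|T x - z| ^+ 2 + (1 - alpha) / alpha * `|x - T x| ^+ 2 <= `|x - z| ^+ 2.
Proof.
move=> hE /andP[a0 a1] [S nS TE] Tz.
have Sz : S z = z.
  have : alpha *: (S z - z) = T z - z.
    by rewrite TE scalerBl scale1r [RHS]addrC addrA addKr addrC scalerBr.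
  by rewrite Tz subrr => /eqP; rewrite scaler_eq0 (gt_eqF a0)/= subr_eq0 => /eqP.
have e1 : T x - z = (1 - alpha) *: (x - z) + alpha *: (S x - z).
  by rewrite TE !scalerBr addrACA -opprD -scalerDl subrK scale1r.
have e2 : x - T x = alpha *: (x - S x).
  by rewrite TE scalerBl scale1r scalerBr opprD opprB addrA addrCA subrr addr0.
have e3 : (x - z) - (S x - z) = x - S x by rewrite opprB addrA subrK.
rewrite e1 (sqr_norm_convex hE) e3 e2 normrZ gtr0_norm// exprMn.
have h : `|S x - z| ^+ 2 <= `|x - z| ^+ 2 by rewrite ler_sqr ?nnegrE// -[in leLHS]Sz nS.
have -> : (1 - alpha) / alpha * (alpha ^+ 2 * `|x - S x| ^+ 2) =
   alpha * (1 - alpha) * `|x - S x| ^+ 2 by field; rewrite gt_eqF.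
have := h; rewrite -(ler_pM2l a0); lra.
Qed.

(** Nonnegativity of the variance of a under the weights w. *)
Lemma weighted_mean_sqr (R : realType) (m : nat) (w a : 'I_m -> R) :
  (forall i, 0 <= w i) -> \sum_i w i = 1 ->
  (\sum_i w i * a i) ^+ 2 <= \sum_i w i * a i ^+ 2.
Proof.
move=> w0 w1.
have key mu : \sum_i w i * (a i - mu) ^+ 2 =
    \sum_i w i * a i ^+ 2 - 2 * mu * \sum_i w i * a i + mu ^+ 2 * \sum_i w i.
  rewrite !mulr_sumr -sumrB -big_split/=; apply: eq_bigr => i _; ring.
have := key (\sum_i w i * a i); rewrite w1.
have : 0 <= \sum_i w i * (a i - \sum_i w i * a i) ^+ 2.
  by apply: sumr_ge0 => i _; rewrite mulr_ge0// sqr_ge0.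
lra.
Qed.

Lemma norm_weighted_mean_sqr (R : realType) (E : normedModType R) (m : nat)
    (w : 'I_m -> R) (v : 'I_m -> E) :
  (forall i, 0 <= w i) -> \sum_i w i = 1 ->
  `|\sum_i w i *: v i| ^+ 2 <= \sum_i w i * `|v i| ^+ 2.
Proof.
move=> w0 w1; apply: le_trans (weighted_mean_sqr (fun i => `|v i|) w0 w1).
rewrite ler_sqr ?nnegrE//; last by apply: sumr_ge0 => i _; rewrite mulr_ge0.
rewrite (le_trans (ler_norm_sum _ _ _))// ler_sum// => i _.
by rewrite normrZ ger0_norm.
Qed.

Lemma weighted_mean_const (R : realType) (E : normedModType R) (m : nat)
    (w : 'I_m -> R) (z : E) :
  \sum_i w i = 1 -> \sum_i w i *: z = z.
Proof. by move=> w1; rewrite -scaler_suml w1 scale1r. Qed.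

Lemma weight_ge_inf_weight (R : realType) (m : nat) (w : nat -> 'I_m -> R) k i :
  (forall k i, 0 <= w k i) -> i \in active w k -> inf_weight w <= w k i.
Proof.
move=> w0 ik; rewrite /inf_weight.
apply: (@le_trans _ _ (\big[Num.min/1]_(j in active w k) w k j)).
  apply: ge_inf; last by exists k.
  by exists 0 => _ [n _ <-]; apply: le_bigmin.
exact: bigmin_le_cond.
Qed.

Lemma dist_has_inf (R : realType) (E : normedModType R) (C : set E) (x : E) :
  C !=set0 -> has_inf [set `|x - c| | c in C].
Proof.
by move=> [c Cc]; split; [exists `|x - c|; exists c|exists 0 => _ [d _ <-]].
Qed.

Lemma dist_ge0 (R : realType) (E : normedModType R) (C : set E) (x : E) :
  C !=set0 -> 0 <= dist x C.
Proof.
move=> C0; apply: lb_le_inf; first by case: (dist_has_inf x C0).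
by move=> _ [c _ <-].
Qed.

Lemma dist_lipschitz (R : realType) (E : normedModType R) (C : set E) (x y : E) :
  C !=set0 -> dist x C <= dist y C + `|x - y|.
Proof.
move=> C0; rewrite -lerBlDr; apply: lb_le_inf; first by case: (dist_has_inf y C0).
move=> _ [c Cc <-]; rewrite lerBlDr.
apply: (@le_trans _ _ `|x - c|).
  by apply: ge_inf; [case: (dist_has_inf x C0)|exists c].
by rewrite [leRHS]addrC -(subrKA y x) ler_normD.
Qed.

Lemma dist_continuous (R : realType) (E : normedModType R) (C : set E) :
  C !=set0 -> continuous (fun x : E => dist x C).
Proof.
move=> C0 x; apply/cvgrPdist_le => e e0; near=> y.
have xy : `|x - y| <= e by near: y; apply: cvgr_dist_le => //; exact: cvg_id.
have h1 := dist_lipschitz x y C0; have := dist_lipschitz y x C0.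
by rewrite distrC => h2; rewrite ler_norml; apply/andP; split; lra.
Unshelve. all: by end_near.
Qed.

Lemma displacement_le_dist (R : realType) (E : normedModType R) (C : set E)
    (T : E -> E) (x : E) :
  C !=set0 -> nonexpansive T -> (forall z, C z -> T z = z) ->
  `|x - T x| <= 2 * dist x C.
Proof.
move=> C0 nT Tz; rewrite mulrC -ler_pdivrMr//.
apply: lb_le_inf; first by case: (dist_has_inf x C0).
move=> _ [c Cc <-]; rewrite ler_pdivrMr// mulrC.
have -> : x - T x = (x - c) - (T x - T c).
  by rewrite (Tz c Cc) opprB addrA subrK.
by rewrite (le_trans (ler_normB _ _))// mulr2n mulrDl mul1r lerD2l nT.
Qed.

(** The squared distance to z drops at each step by at least c * e k, hence e k tends to 0. This
    controls the steps and, through nu, the displacements of the active operators. Each operator is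
    active at some time in a window of length s, and its displacement there is carried back to the
    start of the window by nonexpansiveness. *)
Lemma quasi_cyclic_residual (R : realType) (E : normedModType R) (alpha nu : R)
    (m : nat) (T : 'I_m -> E -> E) (w : nat -> 'I_m -> R) (x : nat -> E)
    (s : nat) (z : E) (eps : R) :
  euclidean_space E -> 0 < alpha < 1 -> (forall i, averaged alpha (T i)) ->
  (forall i, T i z = z) ->
  (forall k, x k.+1 = \sum_(i < m) w k i *: T i (x k)) ->
  (forall k i, 0 <= w k i) -> (forall k, \sum_(i < m) w k i = 1) ->
  0 < nu -> (forall k i, i \in active w k -> nu <= w k i) ->
  (forall k, (\bigcup_(j < s) active w (k + j) = [set: 'I_m])%SET) ->
  0 < eps -> exists k, forall i, `|x k - T i (x k)| <= eps.
Proof.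
move=> hE halpha hT Tz hx w0 w1 nu0 hnu hcyc eps0.
have /andP[a0 a1] := halpha.
pose e k := \sum_(i < m) w k i * `|x k - T i (x k)| ^+ 2.
pose D k := `|x k - z| ^+ 2.
pose c := (1 - alpha) / alpha; have c0 : 0 < c by rewrite divr_gt0// subr_gt0.
have De k : D k.+1 + c * e k <= D k.
  have h : D k.+1 <= \sum_i w k i * `|T i (x k) - z| ^+ 2.
    rewrite /D hx -{1}(weighted_mean_const z (w1 k)) -sumrB.
    under eq_bigr do rewrite -scalerBr.
    exact: norm_weighted_mean_sqr.
  apply: (@le_trans _ _ (\sum_i w k i * `|T i (x k) - z| ^+ 2 + c * e k)).
    by rewrite lerD2r.
  have -> : D k = \sum_i w k i * D k by rewrite -mulr_suml w1 mul1r.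
  rewrite mulr_sumr -big_split/= ler_sum// => i _.
  by rewrite [c * _]mulrCA -mulrDr ler_wpM2l// averaged_fixed_sqr.
have e_ge0 k : 0 <= e k.
  by apply: sumr_ge0 => i _; rewrite mulr_ge0// sqr_ge0.
have Dni : nonincreasing_seq D.
  apply/nonincreasing_seqP => k; have := De k.
  have : 0 <= c * e k by rewrite mulr_ge0// ltW.
  lra.
have cD : cvgn D.
  by apply: nonincreasing_is_cvgn => //; exists 0 => _ [k _ <-]; exact: sqr_ge0.
have dD : (fun k => D k - D k.+1) @ \oo --> (0 : R).
  rewrite -(subrr (limn D)); apply: cvgB; first exact: cD.
  by rewrite (cvg_shiftS D).
(* The final triangle inequality costs s * eta for the way to the active time, eta for the
   displacement there, and s * eta for the way back. *)
pose eta := eps / (2 * s%:R + 1).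
have s1 : 0 < 2 * s%:R + 1 :> R by rewrite ltr_wpDl// mulr_ge0.
have eta0 : 0 < eta by rewrite divr_gt0.
(* The first bound serves the step lengths, the second the active displacements, whose squares carry
   a weight at least nu in e l. *)
have [N HN] : exists N, forall l, (N <= l)%N ->
    e l <= eta ^+ 2 /\ e l <= nu * eta ^+ 2.
  have b0 : 0 < c * (Num.min 1 nu * eta ^+ 2).
    have m0 : 0 < Num.min 1 nu by rewrite lt_min ltr01.
    by rewrite mulr_gt0// mulr_gt0// exprn_gt0.
  have [N _ HN] : \forall l \near \oo, D l - D l.+1 <= c * (Num.min 1 nu * eta ^+ 2).
    exact: cvgr_le dD _ b0.
  exists N => l Nl; have h1 := HN l Nl.
  have h : e l <= Num.min 1 nu * eta ^+ 2.
    by rewrite -(ler_pM2l c0) (le_trans _ h1)//; have := De l; lra.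
  split; apply: (le_trans h).
    by rewrite -[leRHS]mul1r ler_pM2r ?exprn_gt0// ge_min lexx.
  by rewrite ler_pM2r ?exprn_gt0// ge_min lexx orbT.
have norm_le (u : E) : `|u| ^+ 2 <= eta ^+ 2 -> `|u| <= eta.
  by rewrite ler_sqr ?nnegrE// ltW.
have stepN l : (N <= l)%N -> `|x l - x l.+1| <= eta.
  move=> /HN[h _]; apply: norm_le; apply: le_trans h.
  rewrite hx -{1}(weighted_mean_const (x l) (w1 l)) -sumrB.
  under eq_bigr do rewrite -scalerBr.
  exact: norm_weighted_mean_sqr.
have far j : `|x N - x (N + j)%N| <= j%:R * eta.
  elim: j => [|j IH]; first by rewrite addn0 subrr normr0 mul0r.
  rewrite -(subrKA (x (N + j)%N)) (le_trans (ler_normD _ _))//.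
  by rewrite -natr1 mulrDl mul1r lerD// addnS stepN// leq_addr.
exists N => i.
have : i \in (\bigcup_(j < s) active w (N + j))%SET by rewrite hcyc inE.
move=> /bigcupP[j _ ij].
have Tij : `|x (N + j)%N - T i (x (N + j)%N)| <= eta.
  apply: norm_le; have [_ h] := HN (N + j)%N (leq_addr _ _).
  have wn := hnu _ _ ij.
  rewrite -(ler_pM2l nu0) (le_trans _ h)//.
  rewrite (@le_trans _ _ (w (N + j)%N i * `|x (N + j)%N - T i (x (N + j)%N)| ^+ 2))//.
    by rewrite ler_wpM2r ?sqr_ge0.
  rewrite /e (bigD1 i)//= lerDl sumr_ge0// => i' _.
  by rewrite mulr_ge0// sqr_ge0.
have js : j%:R * eta <= s%:R * eta by rewrite ler_pM2r// ler_nat ltnW.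
have h1 := far j.
have h2 := le_trans (averaged_nonexpansive halpha (hT i) (x N) (x (N + j)%N)) h1.
have -> : eps = s%:R * eta + (eta + s%:R * eta).
  by rewrite -[LHS](@divfK _ (2 * s%:R + 1)) ?gt_eqF// -/eta; ring.
rewrite -(subrKA (x (N + j)%N)) (le_trans (ler_normD _ _))//.
rewrite lerD ?(le_trans h1)//.
rewrite -(subrKA (T i (x (N + j)%N))) (le_trans (ler_normD _ _))// lerD//.
by rewrite distrC (le_trans h2).
Qed.

(* An error bound cannot be better than linear: on a connected B the distance to
   F takes every small value, and displacements are at most twice the distance. *)
Lemma regularity_ge_linear (R : realType) (E : normedModType R) (m : nat)
    (T : 'I_m -> E -> E) (F B : set E) (psi : R -> R) (x0 : E) :
  F !=set0 -> (forall i, nonexpansive (T i)) ->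
  (forall i z, F z -> T i z = z) -> connected B ->
  (forall x, B x -> dist x F <= psi (\big[Num.max/0]_(i < m) `|x - T i x|)) ->
  (forall t u : R, 0 <= t -> t <= u -> psi t <= psi u) ->
  psi t @[t --> 0^'+] --> (0 : R) ->
  (forall eps, 0 < eps -> exists2 x, B x & forall i, `|x - T i x| <= eps) ->
  B x0 -> 0 < dist x0 F -> \forall t \near 0^'+, t / 2 <= psi t.
Proof.
move=> F0 nT Tz cB hpsi psi_nd psi0 hres Bx0 d0.
have max_le x e : 0 <= e -> (forall i, `|x - T i x| <= e) ->
    0 <= \big[Num.max/0]_(i < m) `|x - T i x| <= e.
  move=> e0 h; rewrite bigmax_ge_id/=.
  by apply/bigmax_leP; split.
have itv : is_interval [set dist x F | x in B].
  apply/connected_intervalP; apply: connected_continuous_connected => //.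
  exact/continuous_subspaceT/dist_continuous.
apply/near_at0P; exists (2 * dist x0 F); first by rewrite mulr_gt0.
move=> t /andP[t0 tx]; have t2 : 0 < t / 2 by rewrite divr_gt0.
(* A point with residual at most e lies within t / 2 of F by the error bound, while x0 is at
   distance at least t / 2; connectedness then supplies a point at distance exactly t / 2. *)
have [e e0 pe] : exists2 e, 0 < e & psi e < t / 2.
  have /near_at0P[d dd Hd] : \forall t' \near 0^'+, psi t' < t / 2.
    exact: (cvgr_lt _ psi0 _ t2).
  by exists d => //; apply: Hd; rewrite dd lexx.
have [y By ye] := hres e e0.
have dy : dist y F <= t / 2.
  have /andP[h1 h2] := max_le y e (ltW e0) ye.
  by rewrite (le_trans (hpsi _ By))// (le_trans _ (ltW pe))// psi_nd.
have [b Bb bt] : [set dist x F | x in B] (t / 2).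
  apply: (itv (dist y F) (dist x0 F)); [by exists y|by exists x0|].
  by rewrite dy ler_pdivrMr// mulrC.
rewrite -bt (le_trans (hpsi _ Bb))//.
have /andP[h1 h2] : 0 <= \big[Num.max/0]_(i < m) `|b - T i b| <= t.
  apply: max_le => [|i]; first exact: ltW.
  rewrite (le_trans (displacement_le_dist b F0 (nT i) (Tz i)))// bt.
  by rewrite mulrC divfK.
exact: psi_nd.
Qed.

(** At distance 0 from F all displacements of x 0 vanish, so x 0 is a common fixed point and the
    iteration stays there, which is finite convergence. *)
Lemma quasi_cyclic_dist_gt0 (R : realType) (E : normedModType R) (m : nat)
    (T : 'I_m -> E -> E) (F : set E) (w : nat -> 'I_m -> R) (x : nat -> E) :
  F = \bigcap_(i in [set: 'I_m]) Fix (T i) -> F !=set0 ->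
  (forall i, nonexpansive (T i)) ->
  (forall k, x k.+1 = \sum_(i < m) w k i *: T i (x k)) ->
  (forall k, \sum_(i < m) w k i = 1) ->
  ~ finite_convergence F x -> 0 < dist (x 0%N) F.
Proof.
move=> hF F0 nT hx w1 hfin; rewrite lt_neqAle dist_ge0// andbT.
apply/negP => /eqP d0; apply: hfin.
have Tz i z : F z -> T i z = z by rewrite hF => /(_ i I).
have Tx i : T i (x 0%N) = x 0%N.
  have := displacement_le_dist (x 0%N) F0 (nT i) (Tz i).
  by rewrite -d0 mulr0 normr_le0 subr_eq0 => /eqP.
exists (x 0%N); first by rewrite hF => i _; exact: Tx.
exists 0%N => k _; elim: k => // k IH.
by rewrite hx IH -[RHS](weighted_mean_const _ (w1 k)); apply: eq_bigr => i _; rewrite Tx.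
Qed.

Theorem theorem3p11 (R : realType) (E : normedModType R)
  (hE : euclidean_space E)
  (alpha : R) (halpha : 0 < alpha < 1)
  (m : nat) (hm : (0 < m)%N) (T : 'I_m -> E -> E)
  (hT : forall i, averaged alpha (T i))
  (F : set E) (hF : F = \bigcap_(i in [set: 'I_m]) Fix (T i))
  (hF0 : F !=set0) (hFE : F <> [set: E])
  (w : nat -> 'I_m -> R) (x : nat -> E)
  (hx : forall k, x k.+1 = \sum_(i < m) w k i *: T i (x k))
  (hw0 : forall k i, 0 <= w k i)
  (hw1 : forall k, \sum_(i < m) w k i = 1)
  (nu : R) (hnu : nu = inf_weight w) (hnu0 : 0 < nu)
  (B : set E) (hB : bounded_set B) (hxB : forall k, B (x k))
  (psi : R -> R) (hpsi : jointly_karamata_regular T B psi)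
  (s : nat) (hs : (0 < s)%N)
  (hcyc : forall k, (\bigcup_(j < s) active w (k + j) = [set: 'I_m])%SET)
  (ahat : R) (hahat : dist (x 0%N) F ^+ 2 < ahat)
  (delta : R) (hdelta : 0 < delta)
  (rho : R) (hrho : 0 <= rho <= 1) (hpsirho : RVat0 rho psi)
  (hfin : ~ finite_convergence F x) :
  let Phi_phi := Phi ahat delta (phi_hat alpha nu s psi) in
  let Phi_inv := inv_pos Phi_phi in
  [/\ rho = 0 ->
        [/\ RVat0_ninfty Phi_phi, RV 0 Phi_inv &
            forall r : R, 0 < r ->
              (fun k : nat => (k%:R : R) `^ (- r)) =o_\oo
              (fun k : nat => Phi_inv k%:R)],
      0 < rho < 1 ->
        [/\ RVat0 (1 - 1 / rho) Phi_phi, RV (rho / (rho - 1)) Phi_inv &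
            forall r : R, 0 < r < - (rho / (rho - 1)) ->
              (fun k : nat => Phi_inv k%:R) =o_\oo
              (fun k : nat => (k%:R : R) `^ (- r))] &
      rho = 1 -> closed B -> connected B ->
        [/\ RVat0 0 Phi_phi, RV_ninfty Phi_inv &
            forall r : R, 0 < r ->
              (fun k : nat => Phi_inv k%:R) =o_\oo
              (fun k : nat => (k%:R : R) `^ (- r))]].
Proof.
have F0 := hF0; have ahat0 : 0 < ahat by rewrite (le_lt_trans _ hahat)// sqr_ge0.
have [_ _ hreg [psi_nd psi0 _] _] := hpsi.
have [[ap ap0 [psipos _]] psirho] := hpsirho.
have /andP[a0 a1] := halpha.
pose K := 2 * alpha * (1 + 4 * nu * s%:R) / (nu * (1 - alpha)).
have K0 : 0 < K.
  rewrite divr_gt0 ?mulr_gt0 ?subr_gt0//.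
  by rewrite ltr_pwDl// !mulr_ge0// ltW.
move=> Phi_phi Phi_inv; rewrite /Phi_inv {Phi_inv}.
pose f := phi_hat alpha nu s psi.
have gf : gauge f.
  by apply: (gauge_sqr_sqrt K0) => //; apply/near_at0P; exists ap.
have frho : Karamata_ratio f rho by exact: (Karamata_ratio_sqr_sqrt K0).
have pg := posmono_minus_inv gf ahat0.
have dPhi t0 : density_on t0 (fun t => (minus_inv ahat f t)^-1) Phi_phi.
  exact: oriented_integral_density.
have Phioo_of_linear c : 0 < c -> (\forall u \near 0^'+, c * u <= f u) ->
    Phi_phi u @[u --> 0^'+] --> +oo.
  move=> c0 /(minus_inv_le_linear gf ahat0 c0) H.
  apply: (density_pinfty pg dPhi c0); near=> t.
  have t0 : 0 < t by near: t; exact: nbhs_right_gt.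
  rewrite -invf_div lef_pV2 ?posrE ?divr_gt0 ?minus_inv_gt0//.
  by near: t; exact: H.
have Phioo_lt1 : rho < 1 -> Phi_phi u @[u --> 0^'+] --> +oo.
  move=> rho1; have [|c c0 H] := gauge_ge_linear gf; last exact: Phioo_of_linear H.
  have h2 : (0 : R) < 2^-1 by rewrite invr_gt0.
  (* This strict inequality is where rho < 1 enters: the ratio of f at scale 1/2 eventually exceeds
     1/2. *)
  have hr : 2^-1 < 2^-1 `^ rho :> R.
    have -> : 2^-1 = 2 `^ (-1) :> R by rewrite powR_inv1.
    by rewrite -powRrM; apply: gt1_ltr_powR; [rewrite ltr1n|lra].
  have H : \forall u \near 0^'+, 2^-1 * f u <= f (2^-1 * u).
    apply: (Karamata_ratio_gt frho _ h2 hr); near=> u.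
    by case: gf => + _ _; apply; near: u; exact: nbhs_right_gt.
  near=> u; rewrite mulrC (mulrC u); near: u; exact: H.
split.
- move=> rho0; rewrite rho0 in frho Phioo_lt1.
  have Phioo := Phioo_lt1 ltr01.
  have [h1 h2] := RVat0_ninfty_integral gf ahat0 frho dPhi Phioo.
  split=> // r r0.
  (* Any exponent strictly between 0 and r works: the ratio of the inverse at scale 2 tends to 1,
     which exceeds 2^(-r/2). *)
  have r2 : 0 < r / 2 by rewrite divr_gt0.
  apply: (powR_littleo_inv_pos pg dPhi Phioo _ r2); first by lra.
  have inv0 := near_inv_pos_gt0 pg dPhi Phioo.
  near=> y; rewrite -ler_pdivlMr; last by near: y; exact: inv0.
  rewrite ltW//; near: y; apply: (cvgr_gt _ (h2.2 2 _)) => //.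
  by apply: gt1_ltr_powR; [rewrite ltr1n|lra].
- move=> /andP[rho0 rho1]; have Phioo := Phioo_lt1 rho1.
  have h1 := Karamata_ratio_integral gf ahat0 rho0 frho dPhi Phioo.
  have rn0 : rho != 0 by rewrite gt_eqF.
  have r1 : rho - 1 != 0 by rewrite lt_eqF// subr_lt0.
  have p0 : 1 - 1 / rho < 0 by rewrite subr_lt0 ltr_pdivlMr// mul1r.
  have pE : rho / (rho - 1) = (1 - 1 / rho)^-1.
    by field; rewrite rn0 r1 ?andbT.
  have h2 := RV_inv_pos_neg pg dPhi Phioo p0 h1; rewrite -pE in h2.
  split=> //; first by split=> //; case: (posmeas_at0_density pg dPhi Phioo).
  move=> r /andP[r0]; set q := rho / (rho - 1) in h2 *; move=> rq.
  (* The midpoint of r and -q leaves room on both sides: above r for the little-o, below -q for the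
     ratio at scale 2. *)
  have r'0 : 0 < (r - q) / 2 by lra.
  apply: (inv_pos_littleo_powR pg dPhi Phioo _ r'0); first by lra.
  have inv0 := near_inv_pos_gt0 pg dPhi Phioo.
  near=> y; rewrite -ler_pdivrMr; last by near: y; exact: inv0.
  rewrite ltW//; near: y; apply: (cvgr_lt _ (h2.2 2 _)) => //.
  by apply: gt1_ltr_powR; [rewrite ltr1n|lra].
- move=> rho1 _ cB.
  have nT i := averaged_nonexpansive halpha (hT i).
  have Tz i z : F z -> T i z = z by rewrite hF => /(_ i I).
  have [z Fz] := F0.
  have Phioo : Phi_phi u @[u --> 0^'+] --> +oo.
    have K4 : 0 < K / 4 by rewrite divr_gt0.
    apply: (Phioo_of_linear _ K4); apply: (sqr_sqrt_ge_linear K0).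
    have d0 : 0 < dist (x 0%N) F by exact: (quasi_cyclic_dist_gt0 hF F0 nT hx hw1 hfin).
    apply: (regularity_ge_linear F0 nT Tz cB _ psi_nd psi0 _ (hxB 0%N) d0).
      by rewrite hF.
    move=> eps eps0.
    have hnu' k i : i \in active w k -> nu <= w k i.
      by rewrite hnu; exact: weight_ge_inf_weight.
    have [k hk] := quasi_cyclic_residual hE halpha hT (fun i => Tz i z Fz) hx hw0 hw1
      hnu0 hnu' hcyc eps0.
    by exists (x k).
  rewrite rho1 in frho.
  have h1 := Karamata_ratio_integral gf ahat0 ltr01 frho dPhi Phioo.
  rewrite divr1 subrr in h1.
  have h2 := RV_ninfty_inv_pos pg dPhi Phioo h1.
  split=> //; first by split=> //; case: (posmeas_at0_density pg dPhi Phioo).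
  move=> r r0.
  have r1 : 0 < r + 1 by lra.
  apply: (inv_pos_littleo_powR pg dPhi Phioo _ r1); first by lra.
  (* Slow variation gives Phi (c * u) <= 2 * Phi u near 0 for every c > 0, so any exponent above r,
     here r + 1, is available. *)
  have c0 : (0 : R) < 2 `^ (- (r + 1)) by exact: powR_gt0.
  apply: (inv_pos_scale_le pg dPhi Phioo _ c0) => //.
  by apply: (Karamata_ratio_lt h1 (near0_gt0 Phioo) c0); rewrite powRr0 ltr1n.
Unshelve. all: by end_near.
Qed.
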